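(* Assume that the problem is severely ill-posed with $\sigma_i=\zeta\rho^{-i}$, $\rho>1$, or moderately or mildly ill-posed with $\sigma_i=\zeta i^{-\alpha}$, $\alpha>\frac12$, $i=1,2,\ldots,n$ (with $\zeta>0$ a constant), and let the Ritz values $\theta_i^{(k)}$, i.e. the singular values of $B_k$, be labeled as $\theta_1^{(k)}>\theta_2^{(k)}>\cdots>\theta_k^{(k)}$. Then, for $k=1,\ldots,n-1$, $$0<\sigma_i-\theta_i^{(k)}\leq\sqrt{1+\eta_k^2}\,\sigma_{k+1},\qquad i=1,2,\ldots,k.$$ For $k=1,2,\ldots,k^*$, if $\rho\geq1+\sqrt2$ (in the severely ill-posed case) or $\alpha$ satisfies $$1+\sqrt{1+\eta_k^2}<\left(\frac{k+1}{k}\right)^{\alpha}$$ (in the moderately or mildly ill-posed case), then the $k$ Ritz values strictly interlace the first $k+1$ large singular values of $A$: $$\sigma_{i+1}<\theta_i^{(k)}<\sigma_i,\qquad i=1,2,\ldots,k,$$ which means that the $\theta_i^{(k)}$ approximate the first $k$ large $\sigma_i$ in natural order.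
   Context: $\|\cdot\|$ is the 2-norm (spectral norm for matrices). $A\in\mathbb{R}^{m\times n}$, $m\geq n$, has the SVD $A=U\begin{pmatrix}\Sigma\\ \mathbf 0\end{pmatrix}V^T$ with $U=(u_1,\ldots,u_m)$, $V=(v_1,\ldots,v_n)$ orthogonal, $\Sigma=\mathrm{diag}(\sigma_1,\ldots,\sigma_n)$, and simple singular values $\sigma_1>\cdots>\sigma_n>0$; $\Sigma_k=\mathrm{diag}(\sigma_1,\ldots,\sigma_k)$. The vector $b=b_{true}+e\in\mathbb{R}^m$, with $b_{true}=Ax_{true}$, satisfies $u_i^Tb\neq0$ for $i=1,\ldots,n$. Picard model: $|u_i^Tb_{true}|=\sigma_i^{1+\beta}$, $i=1,\ldots,n$, for some $\beta>0$; $e$ is Gaussian white noise with $|u_i^Te|\approx\eta$ for all $i$ (the noise level $\eta$ is unrelated to $\eta_k$). The transition point $k_0$ is the index with $|u_{k_0}^Tb|\approx|u_{k_0}^Tb_{true}|>|u_{k_0}^Te|\approx\eta$ and $|u_{k_0+1}^Tb|\approx|u_{k_0+1}^Te|\approx\eta$. These approximate relations are read in idealized form: $|u_i^Tb|=\sigma_i^{1+\beta}$ for $i\leq k_0$, and $\frac{\max_{k+1\leq i\leq n}|u_i^Tb|}{\min_{1\leq i\leq k}|u_i^Tb|}=\frac{\sigma_{k+1}^{1+\beta}}{\sigma_k^{1+\beta}}<1$ for $k=1,\ldots,k_0$. Lanczos bidiagonalization: starting from $b$, put $\beta_1p_1=b$, $\alpha_1q_1=A^Tp_1$, and for $i\geq1$,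 $\beta_{i+1}p_{i+1}=Aq_i-\alpha_ip_i$, $\alpha_{i+1}q_{i+1}=A^Tp_{i+1}-\beta_{i+1}q_i$, with the positive numbers $\alpha_i,\beta_i$ normalizing $q_i,p_i$ to unit length. With $P_{k+1}=(p_1,\ldots,p_{k+1})$ and $Q_k=(q_1,\ldots,q_k)$, the columns of $Q_k$ are an orthonormal basis of the Krylov subspace $\mathrm{span}\{A^Tb,(A^TA)A^Tb,\ldots,(A^TA)^{k-1}A^Tb\}$, $P_{k+1}$ has orthonormal columns, and $AQ_k=P_{k+1}B_k$, where $B_k\in\mathbb{R}^{(k+1)\times k}$ is lower bidiagonal with diagonal $\alpha_1,\ldots,\alpha_k$ and subdiagonal $\beta_2,\ldots,\beta_{k+1}$. The process runs to completion without breakdown; the singular values of each $B_k$ are simple. LSQR and $k^*$: the $k$-th LSQR iterate is $x_k^{lsqr}=Q_kB_k^{\dagger}P_{k+1}^Tb$ ($\dagger$ is the Moore-Penrose inverse). The iterates first approach $x_{true}$ and then move away from it (semi-convergence); $k^*$ is the iteration at which semi-convergence occurs, i.e. at which $x_k^{lsqr}$ is the best approximation to $x_{true}$. It is known from earlier work that $k^*\leq k_0$. Definition of $\Delta_k$ ($1\leq k\leq n-1$): let $D=\mathrm{diag}(\sigma_ju_j^Tb)_{j=1}^n$ and let $T_k\in\mathbb{R}^{n\times k}$ be the matrix whose $j$-th row is $(1,\sigma_j^2,\ldots,\sigma_j^{2k-2})$. Partition $D=\mathrm{diag}(D_1,D_2)$ and $T_k=\begin{pmatrix} T_{k1} \\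 T_{k2} \end{pmatrix}$ with $D_1,T_{k1}\in\mathbb{R}^{k\times k}$. Then $\Delta_k=D_2T_{k2}T_{k1}^{-1}D_1^{-1}\in\mathbb{R}^{(n-k)\times k}$. Definition of $\eta_k$: $\eta_k=\epsilon_k/\sigma_{k+1}$ with $\epsilon_k\geq0$ given by $\epsilon_k^2=\|\Sigma_k(I+\Delta_k^T\Delta_k)^{-1}\Delta_k^T\Delta_k\|^2+\|\Sigma_k(I+\Delta_k^T\Delta_k)^{-1}\Delta_k^T\|^2$. *)

(* Defs.v *)
(* Sequences (singular values, singular vectors, Lanczos scalars and vectors,
   Ritz values) are functions on nat read at the indices 1, 2, ...; their
   values outside the relevant range, in particular at 0, are irrelevant.
   Matrices are indexed by ordinals, hence from 0. *)
From mathcomp Require Import all_boot all_order all_algebra.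
From mathcomp Require Import mathcomp_extra boolp classical_sets reals exp.

Set Implicit Arguments.
Unset Strict Implicit.
Unset Printing Implicit Defensive.

Import Order.TTheory GRing.Theory Num.Theory.
Local Open Scope classical_set_scope.
Local Open Scope ring_scope.

Section Norms.
Variable R : realType.

Definition dotv m (x y : 'cV[R]_m) : R := \sum_(i < m) x i 0 * y i 0.

(* The library norm on matrices is the sup norm, hence these definitions. *)
Definition norm2 m (x : 'cV[R]_m) : R := Num.sqrt (dotv x x).

Definition specnorm m n (M : 'M[R]_(m, n)) : R :=
  sup [set norm2 (M *m x) | x in [set x : 'cV[R]_n | norm2 x <= 1]].

End Norms.

Section MoorePenrose.
Variable R : realType.

Definition is_mpinv m n (B : 'M[R]_(m, n)) (X : 'M[R]_(n, m)) : Prop :=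
  [/\ B *m X *m B = B,
      X *m B *m X = X,
      (B *m X)^T = B *m X
    & (X *m B)^T = X *m B].

Definition mpinv m n (B : 'M[R]_(m, n)) : 'M[R]_(n, m) :=
  xget 0 [set X | is_mpinv B X].

Lemma gram_unit r n (F : 'M[R]_(r, n)) : row_free F -> F *m F^T \in unitmx.
Proof.
move=> freeF; rewrite -row_free_unit -kermx_eq0; apply/rowV0P => v.
move/sub_kermxP; rewrite mulmxA => vFF0.
have : v *m F *m (v *m F)^T = 0 by rewrite trmx_mul mulmxA vFF0 mul0mx.
move/(congr1 (fun M : 'M[R]_1 => M 0 0)); rewrite mxE [RHS]mxE => sum0.
have vF0 : v *m F = 0.
  apply/matrixP => i j; rewrite (ord1 i) [RHS]mxE; apply/eqP.
  have sq k : (v *m F) 0 k * (v *m F)^T k 0 = (v *m F) 0 k ^+ 2.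
    by rewrite [in X in _ * X]mxE expr2.
  rewrite -sqrf_eq0; move/eqP: sum0; rewrite (eq_bigr _ (fun k _ => sq k)).
  rewrite psumr_eq0 => [|k _]; last exact: sqr_ge0.
  by move/allP/(_ j (mem_index_enum _)).
by apply: (row_free_inj freeF); rewrite vF0 mul0mx.
Qed.

Lemma is_mpinv_ex m n (B : 'M[R]_(m, n)) : exists X, is_mpinv B X.
Proof.
set C := col_base B; set F := row_base B.
have uF : F *m F^T \in unitmx by apply: gram_unit; apply: row_base_free.
have uC : C^T *m C \in unitmx.
  rewrite -[X in _ *m X]trmxK; apply: gram_unit.
  by rewrite /row_free mxrank_tr; exact: (col_base_full B).
have BE : B = C *m F by rewrite mulmx_base.
clearbody C F.
set Fi := F^T *m invmx (F *m F^T); set Ci := invmx (C^T *m C) *m C^T.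
have FFi : F *m Fi = 1%:M by rewrite /Fi mulmxA mulmxV.
have CiC : Ci *m C = 1%:M by rewrite /Ci -mulmxA mulVmx.
have CiB : Ci *m B = F by rewrite [X in _ *m X]BE mulmxA CiC mul1mx.
have BFi : B *m Fi = C by rewrite [X in X *m _]BE -mulmxA FFi mulmx1.
have BX : B *m (Fi *m Ci) = C *m Ci by rewrite mulmxA BFi.
have XB : Fi *m Ci *m B = Fi *m F by rewrite -mulmxA CiB.
exists (Fi *m Ci); split.
- by rewrite BX -mulmxA CiB.
- by rewrite XB -mulmxA (mulmxA F) FFi mul1mx.
- by rewrite BX /Ci !trmx_mul trmxK trmx_inv trmx_mul trmxK mulmxA.
- by rewrite XB /Fi !trmx_mul trmxK trmx_inv trmx_mul trmxK mulmxA.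
Qed.

Lemma is_mpinv_uniq m n (B : 'M[R]_(m, n)) (X Y : 'M[R]_(n, m)) :
  is_mpinv B X -> is_mpinv B Y -> X = Y.
Proof.
move=> [X1 X2 X3 X4] [Y1 Y2 Y3 Y4].
have BXY : B *m X = B *m Y.
  by rewrite -{1}Y1 -mulmxA -Y3 -{1}X3 -trmx_mul mulmxA X1 Y3.
have XYB : X *m B = Y *m B.
  by rewrite -{1}Y1 -mulmxA mulmxA -X4 -{1}Y4 -trmx_mul -mulmxA (mulmxA B) X1 Y4.
by rewrite -X2 XYB -mulmxA BXY mulmxA Y2.
Qed.

Lemma mpinvP m n (B : 'M[R]_(m, n)) : is_mpinv B (mpinv B).
Proof. by have [X BX] := is_mpinv_ex B; apply: (xgetI 0 BX). Qed.

End MoorePenrose.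

Section SVD.
Variable R : realType.

(* (x_1, ..., x_l) *)
Definition colsmx m (x : nat -> 'cV[R]_m) (l : nat) : 'M[R]_(m, l) :=
  \matrix_(i < m, j < l) x j.+1 i 0.

Definition orthogonal_mx m (Q : 'M[R]_m) : Prop := Q^T *m Q = 1%:M.

(* The m x n matrix with diag(s_1, ..., s_n) on top of a zero block. *)
Definition rect_diag m n (s : nat -> R) : 'M[R]_(m, n) :=
  \matrix_(i < m, j < n) (s j.+1 *+ (i == j :> nat)).

(* Meant for n <= m. The s_i come in any order. *)
Definition is_svd m n (A : 'M[R]_(m, n))
    (u : nat -> 'cV[R]_m) (s : nat -> R) (v : nat -> 'cV[R]_n) : Prop :=
  [/\ orthogonal_mx (colsmx u m),
      orthogonal_mx (colsmx v n),
      forall i, (1 <= i <= n)%N -> 0 <= s i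
    & A = colsmx u m *m rect_diag m n s *m (colsmx v n)^T].

Definition singular_values m n (A : 'M[R]_(m, n)) (s : nat -> R) : Prop :=
  exists u v, is_svd A u s v.

Definition decreasing_upto (n : nat) (s : nat -> R) : Prop :=
  forall i j, (1 <= i)%N -> (i < j)%N -> (j <= n)%N -> s j < s i.

End SVD.

Section Lanczos.
Variable R : realType.

(* Lanczos bidiagonalization, run to completion: al_1, be_1, ..., al_n, be_n
   are positive. The last scalar be_(n+1) only has to be nonnegative: it is the
   norm of A q_n - al_n p_n, which is 0 when b lies in the range of A, in
   particular whenever m = n. In that case p_(n+1) is unconstrained and only
   ever gets multiplied by the zero last row of B_n. *)
Definition lanczos_bidiag m n (A : 'M[R]_(m, n)) (b : 'cV[R]_m)
    (al be : nat -> R) (p : nat -> 'cV[R]_m) (q : nat -> 'cV[R]_n) : Prop :=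
  [/\ be 1%N *: p 1%N = b /\ al 1%N *: q 1%N = A^T *m p 1%N,
      forall i, (1 <= i <= n)%N ->
        be i.+1 *: p i.+1 = A *m q i - al i *: p i,
      forall i, (1 <= i < n)%N ->
        al i.+1 *: q i.+1 = A^T *m p i.+1 - be i.+1 *: q i,
      forall i, (1 <= i <= n)%N ->
        [/\ 0 < al i, 0 < be i, norm2 (p i) = 1 & norm2 (q i) = 1]
    & 0 <= be n.+1 /\ (0 < be n.+1 -> norm2 (p n.+1) = 1)].

(* B_k: diagonal al_1, ..., al_k and subdiagonal be_2, ..., be_(k+1). *)
Definition bidiag_mx (al be : nat -> R) (k : nat) : 'M[R]_(k.+1, k) :=
  \matrix_(i < k.+1, j < k)
    (if i == j :> nat then al j.+1
     else if i == j.+1 :> nat then be j.+2 else 0).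

Definition lsqr_iterate m n (b : 'cV[R]_m) (al be : nat -> R)
    (p : nat -> 'cV[R]_m) (q : nat -> 'cV[R]_n) (k : nat) : 'cV[R]_n :=
  colsmx q k *m mpinv (bidiag_mx al be k) *m (colsmx p k.+1)^T *m b.

(* Semi-convergence occurs at iteration kstar: among all iterates x_1, ..., x_n,
   x_kstar is the best approximation to xtrue. *)
Definition semi_convergence_at n (x : nat -> 'cV[R]_n) (xtrue : 'cV[R]_n)
    (kstar : nat) : Prop :=
  (1 <= kstar <= n)%N /\
  forall j, (1 <= j <= n)%N -> norm2 (x kstar - xtrue) <= norm2 (x j - xtrue).

End Lanczos.

Section IllPosed.
Variable R : realType.

Definition severely_ill_posed (n : nat) (sigma : nat -> R) (zeta rho : R) :=
  1 < rho /\ forall i, (1 <= i <= n)%N -> sigma i = zeta * rho ^- i.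

Definition mod_mildly_ill_posed (n : nat) (sigma : nat -> R) (zeta alpha : R) :=
  2^-1 < alpha /\
  forall i, (1 <= i <= n)%N -> sigma i = zeta * i%:R `^ (- alpha).

(* Idealized transition point k0 under the Picard model with exponent beta;
   c_i stands for u_i^T b. The ratio involves sigma_(k0+1), so k0 < n. *)
Definition transition_point (n : nat) (sigma c : nat -> R) (beta : R)
    (k0 : nat) : Prop :=
  [/\ (1 <= k0 < n)%N,
      forall i, (1 <= i <= k0)%N -> `|c i| = sigma i `^ (1 + beta)
    & forall k, (1 <= k <= k0)%N ->
        let r := sigma k.+1 `^ (1 + beta) / sigma k `^ (1 + beta) in
        (\big[Num.max/0]_(k.+1 <= i < n.+1) `|c i|)
          / (\big[Num.min/`|c 1%N|]_(1 <= i < k.+1) `|c i|) = r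
        /\ r < 1].

End IllPosed.

Section Delta.
Variable R : realType.
(* c_j stands for u_j^T b. *)
Variables (sigma c : nat -> R).

(* Rows (and, for D, columns) off+1, ..., off+l of D and T_k. *)
Definition D_block (off l : nat) : 'M[R]_l :=
  diag_mx (\row_(j < l) (sigma (off + j.+1)%N * c (off + j.+1)%N)).

Definition T_block (k off l : nat) : 'M[R]_(l, k) :=
  \matrix_(i < l, j < k) sigma (off + i.+1)%N ^+ (2 * j).

Definition Delta_mx (n k : nat) : 'M[R]_(n - k, k) :=
  D_block k (n - k) *m T_block k k (n - k)
    *m invmx (T_block k 0 k) *m invmx (D_block 0 k).

Definition Sigma_mx (k : nat) : 'M[R]_k := diag_mx (\row_(j < k) sigma j.+1).

Definition epsilon (n k : nat) : R :=
  let Del := Delta_mx n k in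
  let G := invmx (1%:M + Del^T *m Del) in
  Num.sqrt (specnorm (Sigma_mx k *m G *m Del^T *m Del) ^+ 2
            + specnorm (Sigma_mx k *m G *m Del^T) ^+ 2).

Definition eta (n k : nat) : R := epsilon n k / sigma k.+1.

End Delta.

(* Main.v *)
(* Put n = k + d and let W = V^T Q_k hold the coordinates of q_1, ..., q_k in
   the basis of right singular vectors. Row j of W is sigma_j c_j times the
   values at sigma_j^2 of polynomials of degree < k, whence W = (I; Delta_k) M
   with M M^T = (I + Delta_k^T Delta_k)^-1. This gives explicitly the two blocks
   of Sigma (I - W W^T), whose norm is at most
   sqrt (epsilon_k^2 + sigma_(k+1)^2) = sqrt (1 + eta_k^2) sigma_(k+1).
   The Ritz values are the singular values of A Q_k, so that Courant-Fischer
   gives both bounds. The upper one is strict: equality would put a right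
   singular vector in the Krylov space, i.e. a nonzero polynomial of degree < k
   would vanish at the n - 1 >= k other sigma_j^2.
   In the severe case rho >= 1 + sqrt 2 only makes the gaps large enough if
   eta_k < 1. As (I + D^T D)^-1 D^T = D^T (I + D D^T)^-1, epsilon_k^2 is at most
   twice the squared Frobenius norm of Sigma_k Delta_k^T, whose entries are
   sigma_j (c_j / c_i) l_i (sigma_j^2) with l_i the Lagrange basis polynomials at
   the nodes sigma_1^2, ..., sigma_k^2. For rho^2 >= 5 these decay
   geometrically away from the corner j = k + 1, i = k. *)
Require Import Defs.
From mathcomp Require Import all_boot all_order all_algebra.
From mathcomp Require Import mathcomp_extra boolp classical_sets reals exp.
From mathcomp Require Import ring lra zify.

Set Implicit Arguments.
Unset Strict Implicit.
Unset Printing Implicit Defensive.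

Import Order.TTheory GRing.Theory Num.Theory.
Local Open Scope ring_scope.

(** * Inner product, 2-norm and spectral norm *)

Section EuclideanNorm.
Variable R : realType.

Lemma dotvE m (x y : 'cV[R]_m) : dotv x y = (x^T *m y) 0 0.
Proof. by rewrite mxE; apply: eq_bigr => i _; rewrite mxE. Qed.

Lemma dotvC m (x y : 'cV[R]_m) : dotv x y = dotv y x.
Proof. by apply: eq_bigr => i _; rewrite mulrC. Qed.

Lemma dotvDr m (x y z : 'cV[R]_m) : dotv x (y + z) = dotv x y + dotv x z.
Proof. by rewrite !dotvE mulmxDr mxE. Qed.

Lemma dotvDl m (x y z : 'cV[R]_m) : dotv (y + z) x = dotv y x + dotv z x.
Proof. by rewrite dotvC dotvDr !(dotvC x). Qed.

Lemma dotvZr m a (x y : 'cV[R]_m) : dotv x (a *: y) = a * dotv x y.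
Proof. by rewrite !dotvE -scalemxAr mxE. Qed.

Lemma dotvZl m a (x y : 'cV[R]_m) : dotv (a *: x) y = a * dotv x y.
Proof. by rewrite dotvC dotvZr dotvC. Qed.

Lemma dotvNr m (x y : 'cV[R]_m) : dotv x (- y) = - dotv x y.
Proof. by rewrite -scaleN1r dotvZr mulN1r. Qed.

Lemma dotvNl m (x y : 'cV[R]_m) : dotv (- x) y = - dotv x y.
Proof. by rewrite dotvC dotvNr dotvC. Qed.

Definition dotv_lin := (dotvDl, dotvDr, dotvNl, dotvNr, dotvZl, dotvZr).

Lemma dotv0r m (x : 'cV[R]_m) : dotv x 0 = 0.
Proof. by rewrite -(scale0r 0) dotvZr mul0r. Qed.

Lemma dotv_mulmx m n (M : 'M[R]_(m, n)) x y :
  dotv (M *m x) y = dotv x (M^T *m y).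
Proof. by rewrite !dotvE trmx_mul mulmxA. Qed.

Lemma dotv_ge0 m (x : 'cV[R]_m) : 0 <= dotv x x.
Proof. by apply: sumr_ge0 => i _; rewrite -expr2 sqr_ge0. Qed.

Lemma dotv_eq0 m (x : 'cV[R]_m) : (dotv x x == 0) = (x == 0).
Proof.
apply/eqP/eqP => [x0|->]; last exact: dotv0r.
apply/colP => i; rewrite [RHS]mxE; apply/eqP; rewrite -sqrf_eq0 expr2.
move/eqP: x0; rewrite psumr_eq0 => [|j _]; last by rewrite -expr2 sqr_ge0.
by move/allP/(_ i (mem_index_enum _)).
Qed.

Lemma dotv_gt0 m (x : 'cV[R]_m) : (0 < dotv x x) = (x != 0).
Proof. by rewrite lt0r dotv_ge0 andbT dotv_eq0. Qed.

Lemma cauchy_schwarz m (x y : 'cV[R]_m) :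
  dotv x y ^+ 2 <= dotv x x * dotv y y.
Proof.
have [->|y0] := eqVneq y 0; first by rewrite !dotv0r mulr0 expr0n.
have := dotv_ge0 (dotv y y *: x - dotv x y *: y).
rewrite !dotv_lin (dotvC y x) => h.
rewrite -(ler_pM2l (x := dotv y y)) ?dotv_gt0 //; lra.
Qed.

Lemma norm2_sqr m (x : 'cV[R]_m) : norm2 x ^+ 2 = dotv x x.
Proof. by rewrite sqr_sqrtr ?dotv_ge0. Qed.

Lemma norm2_ge0 m (x : 'cV[R]_m) : 0 <= norm2 x.
Proof. exact: sqrtr_ge0. Qed.

Lemma norm2_gt0 m (x : 'cV[R]_m) : (0 < norm2 x) = (x != 0).
Proof. by rewrite sqrtr_gt0 dotv_gt0. Qed.

Lemma norm20 m : norm2 (0 : 'cV[R]_m) = 0.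
Proof. by rewrite /norm2 dotv0r sqrtr0. Qed.

Lemma norm2Z m a (x : 'cV[R]_m) : norm2 (a *: x) = `|a| * norm2 x.
Proof.
by rewrite /norm2 dotvZl dotvZr mulrA -expr2 sqrtrM ?sqr_ge0 // sqrtr_sqr.
Qed.

Lemma norm2N m (x : 'cV[R]_m) : norm2 (- x) = norm2 x.
Proof. by rewrite /norm2 dotvNl dotvNr opprK. Qed.

Lemma le_norm2 m (x : 'cV[R]_m) C : 0 <= C -> (norm2 x <= C) = (dotv x x <= C ^+ 2).
Proof. by move=> C0; rewrite -norm2_sqr ler_pXn2r ?nnegrE ?norm2_ge0. Qed.

Lemma dotv_le_norm2 m (x y : 'cV[R]_m) : dotv x y <= norm2 x * norm2 y.
Proof.
apply: le_trans (ler_norm _) _; rewrite -sqrtr_sqr /norm2 -sqrtrM ?dotv_ge0 //.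
exact: ler_wsqrtr (cauchy_schwarz x y).
Qed.

Lemma norm2D m (x y : 'cV[R]_m) : norm2 (x + y) <= norm2 x + norm2 y.
Proof.
rewrite le_norm2 ?addr_ge0 ?norm2_ge0 // !dotv_lin (dotvC y x).
have := dotv_le_norm2 x y; have := norm2_sqr x; have := norm2_sqr y; lra.
Qed.

Lemma norm2_isometry m n (Q : 'M[R]_(m, n)) x :
  Q^T *m Q = 1%:M -> norm2 (Q *m x) = norm2 x.
Proof. by move=> QQ; rewrite /norm2 dotv_mulmx mulmxA QQ mul1mx. Qed.

Lemma dotv_mulmx_frobenius m n (M : 'M[R]_(m, n)) x :
  dotv (M *m x) (M *m x) <= (\sum_i \sum_j M i j ^+ 2) * dotv x x.
Proof.
rewrite mulr_suml; apply: ler_sum => i _.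
have -> : (M *m x) i 0 = dotv (row i M)^T x.
  by rewrite mxE; apply: eq_bigr => j _; rewrite !mxE.
rewrite -expr2; apply: le_trans (cauchy_schwarz _ _) _.
rewrite ler_wpM2r ?dotv_ge0 // le_eqVlt; apply/orP; left; apply/eqP.
by apply: eq_bigr => j _; rewrite !mxE expr2.
Qed.

Lemma frobenius_ge0 m n (M : 'M[R]_(m, n)) : 0 <= \sum_i \sum_j M i j ^+ 2.
Proof. by apply: sumr_ge0 => i _; apply: sumr_ge0 => j _; apply: sqr_ge0. Qed.

Lemma specnorm_ub m n (M : 'M[R]_(m, n)) x :
  norm2 x <= 1 -> norm2 (M *m x) <= specnorm M.
Proof.
move=> x1; apply: ub_le_sup; last by exists x.
exists (Num.sqrt (\sum_i \sum_j M i j ^+ 2)) => _ [y /= y1 <-].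
apply: ler_wsqrtr; apply: le_trans (dotv_mulmx_frobenius _ _) _.
by rewrite ler_piMr ?frobenius_ge0 // -norm2_sqr expr_le1 ?norm2_ge0.
Qed.

Lemma norm2_mulmx_specnorm m n (M : 'M[R]_(m, n)) x :
  norm2 (M *m x) <= specnorm M * norm2 x.
Proof.
have [->|x0] := eqVneq x 0; first by rewrite mulmx0 !norm20 mulr0.
have nx : 0 < norm2 x by rewrite norm2_gt0.
have ni : `|(norm2 x)^-1| = (norm2 x)^-1 by rewrite ger0_norm ?invr_ge0 ?ltW.
rewrite -ler_pdivrMr // mulrC -ni -norm2Z scalemxAr specnorm_ub //.
by rewrite norm2Z ni mulVf ?gt_eqF.
Qed.

Lemma specnorm_le m n (M : 'M[R]_(m, n)) C :
  (forall x, norm2 x <= 1 -> norm2 (M *m x) <= C) -> specnorm M <= C.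
Proof.
move=> h; apply: ge_sup; last by move=> _ [y /= y1 <-]; apply: h.
by exists (norm2 (M *m 0)), 0 => //=; rewrite norm20.
Qed.

Lemma specnorm_ge0 m n (M : 'M[R]_(m, n)) : 0 <= specnorm M.
Proof.
apply: le_trans (norm2_ge0 (M *m 0)) (specnorm_ub M _).
by rewrite norm20.
Qed.

End EuclideanNorm.

(** * Courant-Fischer bounds for the Ritz values *)

Section RitzBounds.
Variable R : realType.

Lemma unitmx_inj d (M : 'M[R]_d) :
  (forall x : 'cV_d, M *m x = 0 -> x = 0) -> M \in unitmx.
Proof.
move=> injM; rewrite unitmxE unitfE -det_tr; apply/negP => /det0P[v v0 vM].
move/eqP: v0; apply; apply: trmx_inj; rewrite trmx0; apply: injM.
by rewrite -[M]trmxK -trmx_mul vM trmx0.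
Qed.

(** The i0 + 1 coordinates up to i0 meet only i0 linear equations. Such a z is the test vector in
    both Courant-Fischer arguments. *)
Lemma exists_truncated_vec d i0 (f : nat -> 'I_d -> R) : (i0 < d)%N ->
  exists z : 'cV[R]_d, [/\ z != 0, forall l : 'I_d, (i0 < l)%N -> z l 0 = 0
    & forall j, (j < i0)%N -> \sum_l f j l * z l 0 = 0].
Proof.
move=> i0d.
(* Rows before i0 hold the equations, rows after i0 read off single coordinates, and row i0 is zero,
   which makes [M] singular. *)
pose M : 'M[R]_d := \matrix_(a, b)
  (if (a < i0)%N then f a b else if (i0 < a)%N then (a == b)%:R else 0).
have : \det M^T = 0.
  rewrite det_tr (expand_det_row _ (Ordinal i0d)) big1 // => j _.
  by rewrite mxE /= ltnn mul0r.
move/eqP/det0P => [v v0 vM]; exists v^T.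
have Mv : M *m v^T = 0 by rewrite -[M]trmxK -trmx_mul vM trmx0.
split=> [|l l0|j j0].
- by apply: contra v0 => /eqP v0; apply/eqP/trmx_inj; rewrite v0 trmx0.
- move/colP/(_ l): Mv; rewrite mxE [in RHS]mxE => Mv; rewrite -[RHS]Mv.
  rewrite (bigD1 l) //= big1 ?addr0 => [|b /negbTE bl].
    by rewrite [M _ _]mxE ltnNge (ltnW l0) /= l0 eqxx mul1r.
  by rewrite [M _ _]mxE ltnNge (ltnW l0) /= l0 eq_sym bl mul0r.
- move/colP/(_ (Ordinal (ltn_trans j0 i0d))): Mv.
  rewrite mxE [in RHS]mxE => Mv; rewrite -[RHS]Mv.
  by apply: eq_bigr => b _; rewrite [M _ _]mxE /= j0.
Qed.

Lemma dotv_Sigma d (s : nat -> R) (z : 'cV[R]_d) :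
  dotv (Sigma_mx s d *m z) (Sigma_mx s d *m z)
  = \sum_(j < d) s j.+1 ^+ 2 * z j 0 ^+ 2.
Proof.
apply: eq_bigr => j _; rewrite mul_diag_mx !mxE; ring.
Qed.

Lemma le_sqr (a b : R) : 0 <= a -> a <= b -> a ^+ 2 <= b ^+ 2.
Proof. by move=> a0 ab; rewrite ler_pXn2r ?nnegrE // (le_trans a0). Qed.

Lemma decreasing_upto_le d (t : nat -> R) (i j : nat) : decreasing_upto d t ->
  (i <= j)%N -> (j < d)%N -> t j.+1 <= t i.+1.
Proof.
move=> t_dec; rewrite leq_eqVlt => /orP[/eqP->//|ij] jd.
by apply/ltW/t_dec.
Qed.

Variables (n k : nat) (s th : nat -> R) (X : 'M[R]_(n, k)).
Hypothesis kn : (k <= n)%N.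
Hypothesis s_dec : decreasing_upto n s.
Hypothesis s_gt0 : forall i, (1 <= i <= n)%N -> 0 < s i.
Hypothesis th_dec : decreasing_upto k th.
Hypothesis th_ge0 : forall i, (1 <= i <= k)%N -> 0 <= th i.
Hypothesis XX : X^T *m X = 1%:M.
Hypothesis ritz_energy : forall y,
  norm2 (Sigma_mx s n *m (X *m y)) = norm2 (Sigma_mx th k *m y).

Let s_ge0 (i : nat) : (i < n)%N -> 0 <= s i.+1.
Proof. by move=> i_n; apply/ltW/s_gt0. Qed.

(** Take y supported on its first i + 1 coordinates with X y zero in its first i. If
    [s i.+1 <= th i.+1], comparing the energies of y and X y forces equality throughout; as s
    decreases strictly, X y then has at most one nonzero coordinate, so [dense] makes it vanish. *)
Lemma ritz_upper (i : nat) : (i < k)%N ->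
  (forall (y : 'cV_k) (j0 : 'I_n), (forall j : 'I_n, j != j0 -> (X *m y) j 0 = 0) ->
     X *m y = 0) ->
  th i.+1 < s i.+1.
Proof.
move=> ik dense; have i_n := leq_trans ik kn.
(* The default 0 is never read: only rows j < i < n are constrained. *)
pose f j l := oapp (fun j' : 'I_n => X j' l) 0 (insub j).
have [y [y0 y_hi y_lo]] := exists_truncated_vec f ik.
pose x := X *m y.
have x_lo (j : 'I_n) : (j < i)%N -> x j 0 = 0.
  move=> ji; rewrite -(y_lo _ ji) mxE; apply: eq_bigr => l _.
  by rewrite /f valK.
have xy : dotv x x = dotv y y by rewrite dotv_mulmx mulmxA XX mul1mx.
rewrite ltNge; apply/negP => sth.
have s2 : s i.+1 ^+ 2 <= th i.+1 ^+ 2.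
  by apply: le_sqr sth; exact: s_ge0.
have e_lo : s i.+1 ^+ 2 * dotv y y <= \sum_(j < k) th j.+1 ^+ 2 * y j 0 ^+ 2.
  rewrite mulr_sumr; apply: ler_sum => l _; rewrite -expr2.
  have [li|il] := leqP l i; last by rewrite y_hi // expr0n !mulr0.
  rewrite ler_wpM2r ?sqr_ge0 //; apply: le_trans s2 _.
  by apply: le_sqr; [exact: th_ge0 | exact: decreasing_upto_le th_dec _ _].
have gap_ge0 (j : 'I_n) :
    0 <= (s i.+1 ^+ 2 - s j.+1 ^+ 2) * x j 0 ^+ 2.
  have [ij|ji] := leqP i j; last by rewrite x_lo // expr0n mulr0.
  apply: mulr_ge0 (sqr_ge0 _); rewrite subr_ge0.
  by apply: le_sqr; [exact: s_ge0 | exact: decreasing_upto_le s_dec _ _].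
(* The terms are nonnegative, and their sum is at most 0 because the energy of X y is at least
   [s i.+1 ^+ 2] times its squared norm. *)
have gap0 : \sum_(j < n) (s i.+1 ^+ 2 - s j.+1 ^+ 2) * x j 0 ^+ 2 == 0.
  rewrite eq_le sumr_ge0 ?andbT //.
  under eq_bigr do rewrite mulrBl.
  rewrite sumrB -dotv_Sigma -norm2_sqr ritz_energy norm2_sqr dotv_Sigma.
  rewrite -mulr_sumr subr_le0 (le_trans _ e_lo) // -xy.
  by under eq_bigr do rewrite expr2.
have y00 : X *m y = 0.
  apply: (dense y (Ordinal i_n)) => j ji.
  have [ij|ji'|ij] := ltngtP i j; last 2 first.
  - exact: x_lo.
  - by move: ji; rewrite -val_eqE /= ij eqxx.
  move: gap0; rewrite psumr_eq0 // => /allP/(_ j (mem_index_enum _)).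
  rewrite mulf_eq0 sqrf_eq0 => /orP[|/eqP//].
  rewrite subr_eq0 eqrXn2 ?s_ge0 // => /eqP sij.
  by have := @s_dec i.+1 j.+1 isT ij (ltn_ord j); rewrite sij ltxx.
move/eqP: y0; apply; apply/eqP.
by rewrite -dotv_eq0 -xy /x y00 dotv0r.
Qed.

(** For z supported on its first i + 1 coordinates with X^T z zero in its first i, the weighted norm
    of z is at least [s i.+1] |z| and that of X X^T z at most [th i.+1] |z|; the triangle inequality
    leaves [gam] for the rest. *)
Lemma ritz_lower (i : nat) gam : (i < k)%N ->
  (forall z, norm2 (Sigma_mx s n *m (z - X *m (X^T *m z))) <= gam * norm2 z) ->
  s i.+1 <= th i.+1 + gam.
Proof.
move=> ik defect; have i_n := leq_trans ik kn.
pose f l j := oapp (fun l' : 'I_k => X^T l' j) 0 (insub l).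
have [z [z0 z_hi z_lo]] := exists_truncated_vec f i_n.
pose y := X^T *m z.
have y_lo (l : 'I_k) : (l < i)%N -> y l 0 = 0.
  move=> li; rewrite -(z_lo _ li) mxE; apply: eq_bigr => j _.
  by rewrite /f valK.
(* Bessel's inequality, from |z - X y|^2 = |z|^2 - |y|^2. *)
have yz : norm2 y <= norm2 z.
  rewrite le_norm2 ?norm2_ge0 // norm2_sqr.
  have e1 : dotv (X *m y) z = dotv y y by rewrite dotv_mulmx.
  have e2 : dotv (X *m y) (X *m y) = dotv y y.
    by rewrite dotv_mulmx mulmxA XX mul1mx.
  have := dotv_ge0 (z - X *m y); rewrite !dotv_lin (dotvC z (_ *m _)); lra.
have Sz : s i.+1 * norm2 z <= norm2 (Sigma_mx s n *m z).
  rewrite -ler_sqr ?nnegrE ?mulr_ge0 ?norm2_ge0 ?s_ge0 //.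
  rewrite exprMn !norm2_sqr dotv_Sigma mulr_sumr; apply: ler_sum => j _.
  rewrite -expr2; have [ji|ij] := leqP j i; last by rewrite z_hi // expr0n !mulr0.
  rewrite ler_wpM2r ?sqr_ge0 //.
  by apply: le_sqr; [exact: s_ge0 | exact: decreasing_upto_le s_dec _ _].
have Ty : norm2 (Sigma_mx th k *m y) <= th i.+1 * norm2 y.
  have ge0 : 0 <= th i.+1 * norm2 y by rewrite mulr_ge0 ?norm2_ge0 ?th_ge0.
  rewrite le_norm2 // exprMn norm2_sqr dotv_Sigma mulr_sumr; apply: ler_sum => l _.
  rewrite -expr2; have [il|li] := leqP i l; last by rewrite y_lo // expr0n !mulr0.
  rewrite ler_wpM2r ?sqr_ge0 //.
  apply: le_sqr; first exact: (@th_ge0 l.+1 (ltn_ord l)).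
  exact: decreasing_upto_le th_dec _ _.
have nz : 0 < norm2 z by rewrite norm2_gt0.
rewrite -(ler_pM2r nz) mulrDl; apply: le_trans Sz _.
have -> : Sigma_mx s n *m z = Sigma_mx s n *m (X *m y)
    + Sigma_mx s n *m (z - X *m (X^T *m z)).
  by rewrite -mulmxDr addrC subrK.
apply: le_trans (norm2D _ _) _; apply: lerD (defect _).
rewrite ritz_energy; apply: le_trans Ty _.
by rewrite ler_wpM2l ?th_ge0.
Qed.

End RitzBounds.

(** The radicand of [epsilon] for an arbitrary block, so that a free dimension d can stand for n -
    k. *)
Definition sqr_epsilon (R : realType) (s : nat -> R) d k (Del : 'M[R]_(d, k)) : R :=
  specnorm (Sigma_mx s k *m invmx (1%:M + Del^T *m Del) *m Del^T *m Del) ^+ 2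
  + specnorm (Sigma_mx s k *m invmx (1%:M + Del^T *m Del) *m Del^T) ^+ 2.

(** * Distance to the Krylov space, weighted by the singular values *)

Section ProjectionDefect.
Variables (R : realType) (k d : nat).

Lemma dotv_col_mx (a a' : 'cV[R]_k) (b b' : 'cV[R]_d) :
  dotv (col_mx a b) (col_mx a' b') = dotv a a' + dotv b b'.
Proof. by rewrite !dotvE tr_col_mx mul_row_col mxE. Qed.

Variables (s : nat -> R) (Del : 'M[R]_(d, k)) (M : 'M[R]_k) (W : 'M[R]_(k + d, k)).
Hypothesis s_gt0 : forall i, (1 <= i <= k + d)%N -> 0 < s i.
Hypothesis s_dec : decreasing_upto (k + d) s.
Hypothesis d_gt0 : (0 < d)%N.
Hypothesis WE : W = col_mx 1%:M Del *m M.
Hypothesis WW : W^T *m W = 1%:M.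

Let G := invmx (1%:M + Del^T *m Del).

(** Expanding W^T W = I gives M^T (I + Delta^T Delta) M = I, a product of square and hence
    invertible matrices. *)
Lemma gram_inverse : (1%:M + Del^T *m Del) \in unitmx /\ M *m M^T = G.
Proof.
have MKM : M^T *m ((1%:M + Del^T *m Del) *m M) = 1%:M.
  by rewrite -[RHS]WW WE trmx_mul tr_col_mx -!mulmxA (mulmxA (row_mx _ _))
    mul_row_col trmx1 mul1mx.
have [Mt KM] := mulmx1_unit MKM.
have /andP[K_unit M_unit] : ((1%:M + Del^T *m Del) \in unitmx) && (M \in unitmx).
  by rewrite -unitmx_mul.
split=> //; rewrite -[G]mulmx1 -(mulmx1C MKM) /G -mulmxA mulKmx //.
Qed.

Lemma projection_defect z :
  norm2 (Sigma_mx s (k + d) *m (z - W *m (W^T *m z)))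
  <= Num.sqrt (sqr_epsilon s Del + s k.+1 ^+ 2) * norm2 z.
Proof.
rewrite /sqr_epsilon -/G.
set a := specnorm _; set b := specnorm _.
have [K_unit MM] := gram_inverse.
have sk : 0 <= s k.+1 by rewrite ltW // s_gt0 //=; lia.
rewrite -ler_sqr ?nnegrE ?mulr_ge0 ?norm2_ge0 ?sqrtr_ge0 //.
rewrite exprMn !norm2_sqr sqr_sqrtr ?addr_ge0 ?sqr_ge0 //.
pose r := z - W *m (W^T *m z).
have rz : dotv r r <= dotv z z.
  have : dotv (W *m (W^T *m z)) z = dotv (W^T *m z) (W^T *m z).
    by rewrite dotv_mulmx.
  have : dotv (W *m (W^T *m z)) (W *m (W^T *m z)) = dotv (W^T *m z) (W^T *m z).
    by rewrite dotv_mulmx mulmxA WW mul1mx.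
  have := dotv_ge0 (W^T *m z).
  rewrite /r !dotv_lin (dotvC z (W *m _)); lra.
pose z1 := usubmx z; pose z2 := dsubmx z.
have zE : z = col_mx z1 z2 by rewrite vsubmxK.
(* The top block of W W^T z is G (z1 + Delta^T z2), and z1 - G z1 = G Delta^T Delta z1. *)
have top : usubmx r = G *m Del^T *m Del *m z1 - G *m Del^T *m z2.
  have PE : W *m (W^T *m z) = col_mx 1%:M Del *m (G *m (z1 + Del^T *m z2)).
    rewrite WE trmx_mul tr_col_mx zE -!mulmxA mul_row_col trmx1 mul1mx.
    by rewrite (mulmxA M) MM.
  rewrite /r PE linearB /= -/z1 mul_col_mx col_mxKu mul1mx.
  have {1}-> : z1 = G *m ((1%:M + Del^T *m Del) *m z1) by rewrite mulKmx.
  rewrite mulmxDl mul1mx -!mulmxA -mulmxBr -mulmxBr.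
  by rewrite opprD addrA [z1 + _]addrC addrK.
have rE : r = col_mx (usubmx r) (dsubmx r) by rewrite vsubmxK.
have SE : dotv (Sigma_mx s (k + d) *m r) (Sigma_mx s (k + d) *m r)
    = dotv (Sigma_mx s k *m usubmx r) (Sigma_mx s k *m usubmx r)
      + \sum_(j < d) s (k + j)%N.+1 ^+ 2 * dsubmx r j 0 ^+ 2.
  rewrite !dotv_Sigma big_split_ord /=; congr (_ + _).
    by apply: eq_bigr => j _; rewrite [usubmx r j 0]mxE.
  by apply: eq_bigr => j _; rewrite [dsubmx r j 0]mxE.
(* From index k + 1 on every weight is at most [s k.+1], and |r| <= |z|. *)
have bottom : \sum_(j < d) s (k + j)%N.+1 ^+ 2 * dsubmx r j 0 ^+ 2
    <= s k.+1 ^+ 2 * dotv z z.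
  apply: (@le_trans _ _ (s k.+1 ^+ 2 * dotv (dsubmx r) (dsubmx r))).
    rewrite mulr_sumr; apply: ler_sum => j _; rewrite -expr2.
    rewrite ler_wpM2r ?sqr_ge0 //.
    have jd := ltn_ord j; apply: le_sqr; first by rewrite ltW ?s_gt0 //; lia.
    by apply: decreasing_upto_le s_dec _ _; lia.
  rewrite ler_wpM2l ?sqr_ge0 //; apply: le_trans rz.
  by rewrite {3 4}rE dotv_col_mx lerDr dotv_ge0.
have top_le : dotv (Sigma_mx s k *m usubmx r) (Sigma_mx s k *m usubmx r)
    <= (a ^+ 2 + b ^+ 2) * dotv z z.
  have le1 : norm2 (Sigma_mx s k *m usubmx r) <= a * norm2 z1 + b * norm2 z2.
    rewrite top mulmxBr !mulmxA; apply: le_trans (norm2D _ _) _.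
    by rewrite norm2N; apply: lerD; apply: norm2_mulmx_specnorm.
  rewrite -norm2_sqr.
  apply: (@le_trans _ _ ((a * norm2 z1 + b * norm2 z2) ^+ 2)).
    by rewrite ler_pXn2r ?nnegrE ?norm2_ge0 // (le_trans (norm2_ge0 _) le1).
  rewrite zE dotv_col_mx -!norm2_sqr.
  (* Cauchy-Schwarz for the pairs (a, b) and (|z1|, |z2|). *)
  have := sqr_ge0 (a * norm2 z2 - b * norm2 z1); lra.
by rewrite -/r SE mulrDl; apply: lerD.
Qed.

End ProjectionDefect.

(** * A^T A in the basis of right singular vectors *)

Section SVDFacts.
Variables (R : realType) (m n : nat) (A : 'M[R]_(m, n)).
Variables (u : nat -> 'cV[R]_m) (s : nat -> R) (v : nat -> 'cV[R]_n).
Hypothesis mn : (n <= m)%N.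
Hypothesis svdA : is_svd A u s v.

Local Notation V := (colsmx v n).
Local Notation S := (Sigma_mx s n).

Lemma rect_diag_tr_mul p (M : 'M[R]_(m, p)) (j : 'I_n) i :
  ((rect_diag m n s)^T *m M) j i = s j.+1 * M (widen_ord mn j) i.
Proof.
rewrite mxE (bigD1 (widen_ord mn j)) //= big1 ?addr0 => [|l].
  by rewrite !mxE eqxx.
by rewrite !mxE -val_eqE /= => /negbTE->; rewrite mul0r.
Qed.

Lemma svd_normal : V^T *m A^T *m A = S *m S *m V^T.
Proof.
have [UU VV _ ->] := svdA.
rewrite !trmx_mul trmxK !mulmxA [V^T *m _]VV mul1mx -(mulmxA _ _ (colsmx u m)) UU.
rewrite mulmx1; congr (_ *m _).
apply/matrixP => j i; rewrite rect_diag_tr_mul mul_diag_mx !mxE /=.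
by rewrite -val_eqE; case: eqP => [->|]; rewrite ?mulr0.
Qed.

Lemma svd_energy z : norm2 (A *m (V *m z)) = norm2 (S *m z).
Proof.
have [_ VV _ _] := svdA.
rewrite /norm2 !dotv_mulmx tr_diag_mx !mulmxA (_ : _ *m _ = S *m S) //.
by rewrite svd_normal -!mulmxA [V^T *m _]VV mulmx1.
Qed.

Lemma svd_coord b (j : 'I_n) :
  (V^T *m (A^T *m b)) j 0 = s j.+1 * dotv (u j.+1) b.
Proof.
have [_ VV _ ->] := svdA.
rewrite !trmx_mul trmxK !mulmxA [V^T *m _]VV mul1mx -mulmxA rect_diag_tr_mul.
by rewrite mxE; congr (_ * _); apply: eq_bigr => i _; rewrite !mxE.
Qed.

End SVDFacts.

(** * Lanczos vectors: orthonormality and Krylov polynomials *)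

Section LanczosFacts.
Variables (R : realType) (m n : nat) (A : 'M[R]_(m, n)) (b : 'cV[R]_m).
Variables (al be : nat -> R) (p : nat -> 'cV[R]_m) (q : nat -> 'cV[R]_n).
Hypothesis lanczos : lanczos_bidiag A b al be p q.

Lemma lanczos_gt0 i : (i < n)%N -> 0 < al i.+1 /\ 0 < be i.+1.
Proof. by case: lanczos => _ _ _ h _ i_n; have [] := h i.+1 i_n. Qed.

Lemma lanczos_A i : (i < n)%N ->
  A *m q i.+1 = al i.+1 *: p i.+1 + be i.+2 *: p i.+2.
Proof.
by case: lanczos => _ h _ _ _ i_n; rewrite (h i.+1) // addrC subrK.
Qed.

(* The coefficient of q_i is forced to 0 for i = 0, where the recurrence has no
   such term and q 0 is junk. *)
Lemma lanczos_AT i : (i < n)%N ->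
  A^T *m p i.+1 = al i.+1 *: q i.+1 + (be i.+1 *+ (0 < i)%N) *: q i.
Proof.
case: lanczos => [[_ h1] _ h _ _]; case: i => [|i] i_n.
  by rewrite scale0r addr0.
by rewrite (h i.+1) // subrK.
Qed.

(** Both recurrences go through one induction: the new p is orthogonal to the old ones by the
    relations among the q, then the new q by those among the p, the new one included. Indices stop
    at n because p_(n+1) may be arbitrary. *)
Lemma lanczos_orthonormal i : (i <= n)%N -> forall l l', (l < i)%N -> (l' < i)%N ->
  dotv (p l.+1) (p l'.+1) = (l == l')%:R /\
  dotv (q l.+1) (q l'.+1) = (l == l')%:R.
Proof.
have unit l : (l < n)%N -> dotv (p l.+1) (p l.+1) = 1 /\ dotv (q l.+1) (q l.+1) = 1.
  case: lanczos => _ _ _ h _ l_n; have [_ _ pl ql] := h l.+1 l_n.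
  by rewrite -!norm2_sqr pl ql expr1n.
elim: i => [//|i IH i_n]; have {}IH := IH (ltnW i_n).
suff new l : (l < i)%N ->
    dotv (p l.+1) (p i.+1) = 0 /\ dotv (q l.+1) (q i.+1) = 0.
  move=> l l'; rewrite !ltnS (leq_eqVlt l) (leq_eqVlt l').
  move=> /predU1P[->|li] /predU1P[->|l'i].
  - by rewrite eqxx; apply: unit.
  - by rewrite (dotvC (p _)) (dotvC (q _)) gtn_eqF //; apply: new.
  - by rewrite ltn_eqF //; apply: new.
  - exact: IH.
case: i i_n IH => [//|i] i_n IH li.
have l_n : (l < n)%N by lia.
have [ali bei] := lanczos_gt0 i_n.
have newp l0 : (l0 < i.+1)%N -> dotv (p l0.+1) (p i.+2) = 0.
  move=> l0i; apply: (mulfI (lt0r_neq0 bei)); rewrite mulr0 -dotvZr.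
  have -> : be i.+2 *: p i.+2 = A *m q i.+1 - al i.+1 *: p i.+1.
    by rewrite lanczos_A ?(ltnW i_n) // addrC addKr.
  have l0n : (l0 < n)%N by lia.
  rewrite dotvDr dotvNr dotvZr dotvC dotv_mulmx dotvC lanczos_AT // dotvDl !dotvZl.
  have [-> ->] := IH l0 i l0i (ltnSn i).
  case: l0 l0i {l0n} => [|l0] l0i.
    by rewrite mul0r addr0; case: eqP => [<-|_] /=; ring.
  have [_ ->] := IH l0 i (ltnW l0i) (ltnSn i).
  by rewrite (@ltn_eqF l0 i) //; case: eqP => [<-|_] /=; ring.
split; first exact: newp.
apply: (mulfI (lt0r_neq0 ali)); rewrite mulr0 -dotvZr.
have -> : al i.+2 *: q i.+2 = A^T *m p i.+2 - be i.+2 *: q i.+1.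
  by rewrite lanczos_AT //= mulr1n addrK.
rewrite dotvDr dotvNr dotvZr dotvC dotv_mulmx trmxK dotvC lanczos_A // dotvDl !dotvZl.
rewrite newp //; have [_ ->] := IH l i li (ltnSn i).
(* For l = i the coefficient [be i.+2] from A q_(i+1) cancels the subtracted one; for l < i, p_(l+2)
   is one of the older vectors. *)
have [->|l_i] := eqVneq l i.
  by have [-> _] := unit i.+1 i_n; rewrite /=; ring.
rewrite newp ?mulr0 ?addr0 ?subr0 //; lia.
Qed.

Lemma colsmx_orthonormal d (x : nat -> 'cV[R]_d) k :
  (forall l l', (l < k)%N -> (l' < k)%N -> dotv (x l.+1) (x l'.+1) = (l == l')%:R) ->
  (colsmx x k)^T *m colsmx x k = 1%:M.
Proof.
move=> h; apply/matrixP => i j; rewrite !mxE -(h _ _ (ltn_ord i) (ltn_ord j)).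
by apply: eq_bigr => l _; rewrite !mxE.
Qed.

Lemma lanczos_Q_orthonormal k : (k <= n)%N ->
  (colsmx q k)^T *m colsmx q k = 1%:M.
Proof.
by move=> kn; apply: colsmx_orthonormal => l l' lk l'k;
  case: (lanczos_orthonormal kn lk l'k).
Qed.

Lemma lanczos_P_orthonormal k : (k <= n)%N ->
  (colsmx p k)^T *m colsmx p k = 1%:M.
Proof.
by move=> kn; apply: colsmx_orthonormal => l l' lk l'k;
  case: (lanczos_orthonormal kn lk l'k).
Qed.

Lemma lanczos_AQ k : (k <= n)%N ->
  A *m colsmx q k = colsmx p k.+1 *m bidiag_mx al be k.
Proof.
move=> kn; apply/matrixP => i j.
have jn := leq_trans (ltn_ord j) kn.
transitivity ((A *m q j.+1) i 0).
  by rewrite !mxE; apply: eq_bigr => l _; rewrite !mxE.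
rewrite lanczos_A // [LHS]mxE [in LHS]mxE [X in _ + X]mxE.
pose j0 : 'I_k.+1 := widen_ord (leqnSn k) j.
pose j1 : 'I_k.+1 := lift ord0 j.
rewrite [RHS]mxE (bigD1 j0) // (bigD1 j1) /=; last by rewrite -val_eqE /= /bump; lia.
rewrite big1 ?addr0 => [|l /andP[/negbTE l0 /negbTE l1]].
  by rewrite !mxE /= /bump leq0n add1n !eqxx gtn_eqF //; ring.
move: l0 l1; rewrite -!val_eqE /= /bump leq0n add1n => l0 l1.
by rewrite !mxE l0 l1 mulr0.
Qed.

(** As k < n, all k + 1 columns of P_(k+1) are among the orthonormal p_1, ..., p_n, so P_(k+1)
    preserves norms. *)
Lemma lanczos_energy k y : (k < n)%N ->
  norm2 (bidiag_mx al be k *m y) = norm2 (A *m (colsmx q k *m y)).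
Proof.
move=> kn; rewrite mulmxA lanczos_AQ ?(ltnW kn) // -mulmxA.
by rewrite [RHS]norm2_isometry //; apply: lanczos_P_orthonormal.
Qed.

(* Membership of q_(i+1) in the Krylov space, in coordinates on v_1, ..., v_n. *)
Lemma lanczos_krylov (u : nat -> 'cV[R]_m) (s : nat -> R) (v : nat -> 'cV[R]_n) i :
  (n <= m)%N -> is_svd A u s v -> (i < n)%N ->
  exists2 f : {poly R}, (size f <= i.+1)%N & forall j : 'I_n,
    ((colsmx v n)^T *m q i.+1) j 0 = s j.+1 * dotv (u j.+1) b * f.[s j.+1 ^+ 2].
Proof.
move=> mn svdA; elim/ltn_ind: i => i IH i_n.
have [ali bei] := lanczos_gt0 i_n.
case: i => [|i] in IH i_n ali bei *.
  (* q_1 is a multiple of A^T b, hence a constant polynomial. *)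
  exists ((be 1%N * al 1%N)^-1)%:P => [|j]; first exact: size_polyC_leq1.
  rewrite hornerC -(svd_coord mn svdA).
  have [[<- h1] _ _ _ _] := lanczos.
  rewrite -scalemxAr -h1 scalerA -scalemxAr [in RHS]mxE [RHS]mulrC mulKf //.
  by rewrite mulf_neq0 ?lt0r_neq0.
have i_n' := ltnW i_n.
have [f fs fE] := IH i (ltnSn i) i_n'.
have [g gs gE] : exists2 g : {poly R}, (size g <= i.+1)%N & forall j : 'I_n,
    ((colsmx v n)^T *m ((be i.+1 *+ (0 < i)%N) *: q i)) j 0
    = s j.+1 * dotv (u j.+1) b * g.[s j.+1 ^+ 2].
  case: i => [|i] in IH i_n i_n' {ali bei f fs fE} *.
    by exists 0 => [|j]; rewrite ?size_poly0 // scale0r mulmx0 mxE horner0 mulr0.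
  have [g gs gE] := IH i (ltnW (ltnSn _)) (ltnW i_n').
  exists (be i.+2 *: g) => [|j]; first exact: leq_trans (size_scale_leq _ _) (leqW gs).
  by rewrite mulr1n -scalemxAr mxE gE hornerZ; ring.
set c := be i.+2 * al i.+2.
have c0 : c != 0 by rewrite mulf_neq0 ?lt0r_neq0.
(* Eliminating the p gives a three-term recurrence for the q ([qE] below). On coordinates A^T A
   multiplies by sigma_j^2, that is, by 'X on polynomials. *)
exists (c^-1 *: (f * 'X - (al i.+1 ^+ 2 + be i.+2 ^+ 2) *: f - al i.+1 *: g)) => [|j].
  apply: leq_trans (size_scale_leq _ _) _.
  have size_sub (h h' : {poly R}) d :
      (size h <= d)%N -> (size h' <= d)%N -> (size (h - h')%R <= d)%N.
    move=> hd h'd; apply: leq_trans (size_polyD _ _) _.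
    by rewrite size_polyN geq_max hd.
  apply: (size_sub) ; [apply: (size_sub)|].
  - have [->|f0] := eqVneq f 0; first by rewrite mul0r size_poly0.
    by rewrite size_mulX.
  - exact: leq_trans (size_scale_leq _ _) (leqW fs).
  - exact: leq_trans (size_scale_leq _ _) (leqW gs).
have qE : c *: q i.+2 = A^T *m (A *m q i.+1) - (al i.+1 ^+ 2 + be i.+2 ^+ 2) *: q i.+1
    - al i.+1 *: ((be i.+1 *+ (0 < i)%N) *: q i).
  rewrite lanczos_A // mulmxDr -!scalemxAr !lanczos_AT //= mulr1n.
  rewrite !scalerDr !scalerA scalerDl -/c !expr2.
  apply/colP => l; rewrite !mxE; ring.
have mxB (x y : 'cV[R]_n) : (x - y) j 0 = x j 0 - y j 0 by rewrite !mxE.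
have mxZ a (x : 'cV[R]_n) : (a *: x) j 0 = a * x j 0 by rewrite mxE.
have AAE : ((colsmx v n)^T *m (A^T *m (A *m q i.+1))) j 0
    = s j.+1 ^+ 2 * ((colsmx v n)^T *m q i.+1) j 0.
  rewrite !mulmxA (svd_normal mn svdA) -!mulmxA !mul_diag_mx.
  by rewrite mxE [in LHS]mxE mxE mulrA mxE expr2.
apply: (mulfI c0); rewrite -mxZ scalemxAr qE !mulmxBr !mxB AAE.
rewrite -[_ *m (al i.+1 *: _)]scalemxAr mxZ gE -scalemxAr mxZ fE.
rewrite !(hornerD, hornerN, hornerZ, hornerM, hornerX).
by field.
Qed.

End LanczosFacts.

(** * A Frobenius bound for the two terms of epsilon_k^2 *)

Section RegularizedInverse.
Variable R : realType.

Lemma add1_gram_unit d k (M : 'M[R]_(d, k)) : 1%:M + M^T *m M \in unitmx.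
Proof.
apply: unitmx_inj => x; rewrite mulmxDl mul1mx -mulmxA => /(congr1 (dotv x)).
rewrite dotv0r dotvDr -dotv_mulmx => h; apply/eqP; rewrite -dotv_eq0 eq_le dotv_ge0.
by rewrite andbT -h lerDl dotv_ge0.
Qed.

Variables (k d : nat) (S : 'M[R]_k) (M : 'M[R]_(d, k)).

Let G := invmx (1%:M + M^T *m M).
Let H := invmx (1%:M + M *m M^T).

(** This is (I + M^T M) M^T = M^T (I + M M^T) with the inverses moved across; it serves to bring S
    next to M^T. *)
Lemma push_through : G *m M^T = M^T *m H.
Proof.
have uG : 1%:M + M^T *m M \in unitmx by apply: add1_gram_unit.
have uH : 1%:M + M *m M^T \in unitmx by rewrite -{1}[M]trmxK add1_gram_unit.
apply: (can_inj (mulKmx uG)); rewrite mulKVmx // mulmxA mulmxDl mul1mx -mulmxA.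
by rewrite -[X in X + _]mulmx1 -mulmxDr -mulmxA mulmxV // mulmx1.
Qed.

(** After [push_through] the two matrices are S M^T times H M and S M^T times H. Both right factors
    have norm at most 1, so each spectral norm is at most the Frobenius norm of S M^T. *)
Lemma sum_specnorm_le_frobenius :
  specnorm (S *m G *m M^T *m M) ^+ 2 + specnorm (S *m G *m M^T) ^+ 2
  <= 2 * \sum_i \sum_j (S *m M^T) i j ^+ 2.
Proof.
have uH : 1%:M + M *m M^T \in unitmx by rewrite -{1}[M]trmxK add1_gram_unit.
set F := \sum_i _; have F0 : 0 <= F by apply: frobenius_ge0.
have bound l (N : 'M_(d, l)) :
    (forall x, dotv (H *m (N *m x)) (H *m (N *m x)) <= dotv x x) ->
    specnorm (S *m G *m M^T *m N) ^+ 2 <= F.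
  move=> contr; rewrite -[F]sqr_sqrtr //; apply: le_sqr (specnorm_ge0 _) _.
  apply: specnorm_le => x x1; apply: ler_wsqrtr.
  rewrite -(mulmxA S) push_through -!mulmxA mulmxA.
  apply: le_trans (dotv_mulmx_frobenius _ _) _; rewrite ler_piMr //.
  by apply: le_trans (contr x) _; rewrite -norm2_sqr expr_le1 ?norm2_ge0.
have HE (x : 'cV_d) : H *m x + M *m (M^T *m (H *m x)) = x.
  by rewrite -[RHS](mulKVmx uH) mulmxDl mul1mx -mulmxA.
rewrite mulr_natl mulr2n; apply: lerD.
  (* Pairing y + M M^T y = M x with y gives |y|^2 + |M^T y|^2 = <x, M^T y>, hence |y| <= |x|. *)
  apply: bound => x; have := congr1 (dotv (H *m (M *m x))) (HE (M *m x)).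
  rewrite dotvDr.
  set y := H *m (M *m x).
  have e1 : dotv y (M *m (M^T *m y)) = dotv (M^T *m y) (M^T *m y).
    by rewrite dotvC dotv_mulmx.
  have e2 : dotv y (M *m x) = dotv x (M^T *m y) by rewrite dotvC dotv_mulmx.
  rewrite e1 e2; have := dotv_ge0 (x - M^T *m y).
  rewrite !dotv_lin (dotvC (_ *m _) x).
  have := dotv_ge0 (M^T *m y); have := dotv_ge0 x; lra.
(* Here N = I, and |x|^2 = |y|^2 + 2 |M^T y|^2 + |M M^T y|^2 for y = H x. *)
rewrite -[_ *m M^T]mulmx1; apply: bound => x; rewrite mul1mx.
have := HE x; set y := H *m x => <-.
have e1 : dotv y (M *m (M^T *m y)) = dotv (M^T *m y) (M^T *m y).
  by rewrite dotvC dotv_mulmx.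
rewrite !dotv_lin (dotvC (_ *m _) y) e1.
have := dotv_ge0 (M^T *m y); have := dotv_ge0 (M *m (M^T *m y)); lra.
Qed.

End RegularizedInverse.

(** * Delta_k as a weighted Lagrange interpolation matrix *)

Section DeltaEntries.
Variables (R : realType) (s c : nat -> R) (k d : nat).
Hypothesis s_gt0 : forall i, (1 <= i <= k + d)%N -> 0 < s i.
Hypothesis s_dec : decreasing_upto (k + d) s.
Hypothesis c_neq0 : forall i, (1 <= i <= k + d)%N -> c i != 0.

Lemma sqr_sigma_inj i j : (i < k + d)%N -> (j < k + d)%N ->
  s i.+1 ^+ 2 = s j.+1 ^+ 2 -> i = j.
Proof.
move=> ik jk /eqP; rewrite eqrXn2 ?ltW ?s_gt0 // => /eqP sij.
have [ij|ji|//] := ltngtP i j.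
  by have := @s_dec i.+1 j.+1 isT ij jk; rewrite sij ltxx.
by have := @s_dec j.+1 i.+1 isT ji ik; rewrite sij ltxx.
Qed.

Lemma poly_sigma_eq0 (f : {poly R}) (r : seq nat) :
  uniq r -> (size f <= size r)%N -> {in r, forall i, (i < k + d)%N} ->
  {in r, forall i, f.[s i.+1 ^+ 2] = 0} -> f = 0.
Proof.
move=> ur fr rk fr0.
apply: (@roots_geq_poly_eq0 _ _ [seq s i.+1 ^+ 2 | i <- r]).
- by apply/allP => _ /mapP[i ir ->]; apply/eqP/fr0.
- rewrite map_inj_in_uniq // => i j ir jr; apply: sqr_sigma_inj; exact: rk.
- by rewrite size_map.
Qed.

Lemma T_block_mul_coef (off l : nat) (f : {poly R}) (i : 'I_l) : (size f <= k)%N ->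
  \sum_(j < k) T_block s k off l i j * f`_j = f.[s (off + i.+1)%N ^+ 2].
Proof.
move=> fk; rewrite (horner_coef_wide _ fk); apply: eq_bigr => j _.
by rewrite mxE exprM mulrC.
Qed.

Lemma T_block_unit : T_block s k 0 k \in unitmx.
Proof.
(* A kernel vector of this Vandermonde matrix holds the coefficients of a polynomial of degree < k
   with k distinct roots. *)
apply: unitmx_inj => x Tx; pose f := \poly_(j < k) oapp (fun j => x j 0) 0 (insub j).
have xE (j : 'I_k) : f`_j = x j 0 by rewrite coef_poly ltn_ord valK.
have f0 : f = 0.
  apply: (@poly_sigma_eq0 _ (iota 0 k)); rewrite ?iota_uniq ?size_iota ?size_poly //.
    by move=> i; rewrite mem_iota; lia.
  move=> i; rewrite mem_iota add0n /= => ik.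
  have := T_block_mul_coef 0 (Ordinal ik) (size_poly k _ : (size f <= k)%N).
  rewrite add0n /= => <-; move/colP/(_ (Ordinal ik)): Tx.
  rewrite mxE [in RHS]mxE => Tx; rewrite -[RHS]Tx.
  by apply: eq_bigr => j _; rewrite xE.
by apply/colP => j; rewrite -xE f0 coef0 mxE.
Qed.

Lemma D_block_unit : D_block s c 0 k \in unitmx.
Proof.
apply: unitmx_inj => x /colP Dx; apply/colP => i.
have := Dx i; rewrite mul_diag_mx !mxE add0n => /eqP.
have ik := ltn_ord i.
have i1 : (1 <= i.+1 <= k + d)%N by lia.
by rewrite !mulf_eq0 (negbTE (c_neq0 i1)) gt_eqF ?s_gt0 //= => /eqP.
Qed.

(** [Delta_mx] with d in place of n - k, for use in dimension k + d. *)
Definition Delta_block : 'M[R]_(d, k) :=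
  D_block s c k d *m T_block s k k d *m invmx (T_block s k 0 k)
    *m invmx (D_block s c 0 k).

(** With Y the coefficient matrix of the polynomials, W = D T_k Y. Then M = D_1 T_k1 Y, and Delta_k
    turns this upper block into the lower one. *)
Lemma krylov_col_mx (W : 'M[R]_(k + d, k)) (f : 'I_k -> {poly R}) :
  (forall i, (size (f i) <= k)%N) ->
  (forall j i, W j i = s j.+1 * c j.+1 * (f i).[s j.+1 ^+ 2]) ->
  exists M, W = col_mx 1%:M Delta_block *m M.
Proof.
move=> fk WE; pose Y : 'M_k := \matrix_(l, i) (f i)`_l.
have blk off l (i : 'I_l) (j : 'I_k) :
    (D_block s c off l *m (T_block s k off l *m Y)) i j =
    s (off + i.+1)%N * c (off + i.+1)%N * (f j).[s (off + i.+1)%N ^+ 2].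
  rewrite mul_diag_mx !mxE -(T_block_mul_coef _ _ (fk j)).
  by congr (_ * _); apply: eq_bigr => h _; rewrite [Y _ _]mxE.
exists (D_block s c 0 k *m (T_block s k 0 k *m Y)).
rewrite mul_col_mx mul1mx /Delta_block -!mulmxA mulKmx ?D_block_unit //.
rewrite mulKmx ?T_block_unit // -[LHS]vsubmxK; congr col_mx; apply/matrixP => i j.
  by rewrite blk mxE WE.
by rewrite blk mxE WE /= addnS.
Qed.

(** T_k2 T_k1^-1 is interpolation: entry (j, i) is the i-th Lagrange basis polynomial evaluated at
    the j-th node beyond the first k. *)
Definition lagrange_mx : 'M[R]_(d, k) := T_block s k k d *m invmx (T_block s k 0 k).

(** The product of the X - sigma_l^2 over l != i has degree k - 1, so interpolation at the k nodes
    reproduces it, and it vanishes at every node but the i-th. *)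
Lemma lagrange_mxP (j : 'I_d) (i : 'I_k) :
  lagrange_mx j i * \prod_(l < k | l != i) (s i.+1 ^+ 2 - s l.+1 ^+ 2)
  = \prod_(l < k | l != i) (s (k + j).+1 ^+ 2 - s l.+1 ^+ 2).
Proof.
pose f := \prod_(l < k | l != i) ('X - (s l.+1 ^+ 2)%:P).
have fE x : f.[x] = \prod_(l < k | l != i) (x - s l.+1 ^+ 2).
  by rewrite horner_prod; apply: eq_bigr => l _; rewrite hornerXsubC.
have fk : (size f <= k)%N.
  rewrite /f -big_filter size_prod_XsubC; have [r _ _ [_ ->]] := big_enumP.
  by rewrite (cardC1 i) card_ord prednK // (leq_ltn_trans _ (ltn_ord i)).
have LT : lagrange_mx *m T_block s k 0 k = T_block s k k d.
  by rewrite mulmxKV ?T_block_unit.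
rewrite -!fE -addnS -(T_block_mul_coef _ _ fk) -LT.
transitivity ((lagrange_mx *m (T_block s k 0 k *m \col_l f`_l)) j 0); last first.
  by rewrite mulmxA mxE; apply: eq_bigr => l _; rewrite [(\col__ _) _ _]mxE.
have TfE (l : 'I_k) : (T_block s k 0 k *m \col_h f`_h) l 0 = f.[s l.+1 ^+ 2].
  rewrite -[s l.+1]/(s (0 + l.+1)%N) -(T_block_mul_coef _ _ fk) mxE.
  by apply: eq_bigr => h _; rewrite [(\col__ _) _ _]mxE.
rewrite [RHS]mxE (bigD1 i) //= TfE big1 ?addr0 // => l li.
by rewrite TfE fE (bigD1 l) //= subrr mul0r mulr0.
Qed.

(** These are the entries of Sigma_k Delta_k^T; the factor [s i.+1] cancels the singular value in
    D_1^-1. *)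
Lemma Delta_blockE (j : 'I_d) (i : 'I_k) :
  s i.+1 * Delta_block j i
  = s (k + j).+1 * (c (k + j).+1 / c i.+1) * lagrange_mx j i.
Proof.
have ik := ltn_ord i; have i1 : (1 <= i.+1 <= k + d)%N by lia.
have DE : Delta_block *m D_block s c 0 k = D_block s c k d *m lagrange_mx.
  by rewrite mulmxKV ?D_block_unit // /lagrange_mx mulmxA.
move/matrixP/(_ j i): DE; rewrite mul_mx_diag mul_diag_mx [LHS]mxE [RHS]mxE.
rewrite ![(\row__ _) _ _]mxE add0n addnS => DE.
apply: (mulIf (c_neq0 i1)); transitivity (Delta_block j i * (s i.+1 * c i.+1)).
  by ring.
by rewrite DE; field; exact: c_neq0.
Qed.

End DeltaEntries.

(** * Geometric sums and products *)

Section Geometric.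
Variables (R : realType) (r : R).

Lemma sum_expr_le C d : 0 <= r -> 0 <= C -> 1 <= C * (1 - r) ->
  \sum_(j < d) r ^+ j <= C.
Proof.
move=> r0 C0 Cr.
(* Keeping the tail lets the induction close, as r^d <= C r^d (1 - r). *)
suff : \sum_(j < d) r ^+ j <= C - C * r ^+ d.
  by move=> /le_trans; apply; rewrite gerBl mulr_ge0 ?exprn_ge0.
elim: d => [|d IH]; first by rewrite big_ord0 expr0 mulr1 subrr.
rewrite big_ord_recr /= exprS; apply: le_trans (lerD IH (lexx _)) _.
have := exprn_ge0 d r0; nra.
Qed.

Lemma prod_1_sub_expr_ge i : 0 <= r -> r <= 5^-1 ->
  3 / 4 <= \prod_(0 <= l < i) (1 - r ^+ (i - l)).
Proof.
move=> r0 r5.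
(* The surplus absorbs the next factor; the base case and the first step are tight at r = 1/5. *)
suff : 3 / 4 + 5 / 4 * r ^+ i.+1 <= \prod_(0 <= l < i) (1 - r ^+ (i - l)).
  by move=> h; apply: le_trans h; rewrite lerDl mulr_ge0 ?divr_ge0 ?exprn_ge0.
elim: i => [|i IH]; first by rewrite big_nil expr1; lra.
rewrite big_nat_recl // subn0; under eq_bigr do rewrite subSS.
have y0 := exprn_ge0 i.+1 r0.
have y5 : r ^+ i.+1 <= 5^-1.
  rewrite exprS; have : r ^+ i <= 1 by apply: exprn_ile1 => //; lra.
  by have := exprn_ge0 i r0; nra.
have := ler_wpM2l (_ : 0 <= 1 - r ^+ i.+1) IH.
rewrite subr_ge0 => /(_ (le_trans y5 _)) h; apply: le_trans (h _); last by lra.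
rewrite (exprS r i.+1); nra.
Qed.

End Geometric.

(** * The severely ill-posed case: epsilon_k < sigma_(k+1) *)

Section SeverelyIllPosed.
Variables (R : realType) (s c : nat -> R) (zeta rho : R) (k d : nat).
Hypothesis s_gt0 : forall i, (1 <= i <= k + d)%N -> 0 < s i.
Hypothesis s_dec : decreasing_upto (k + d) s.
Hypothesis c_neq0 : forall i, (1 <= i <= k + d)%N -> c i != 0.
Hypothesis d_gt0 : (0 < d)%N.
Hypothesis rho_gt0 : 0 < rho.
Hypothesis rho5 : 5 <= rho ^+ 2.
Hypothesis sE : forall i, (1 <= i <= k + d)%N -> s i = zeta * rho ^- i.
Hypothesis c_decay : forall i j, (1 <= i <= k)%N -> (k < j <= k + d)%N ->
  `|c j| <= rho^-1 * `|c i|.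

Let r := rho ^- 2.

Let r_gt0 : 0 < r.
Proof. by rewrite invr_gt0 exprn_gt0. Qed.

Let r_le5 : r <= 5^-1.
Proof. by rewrite /r lef_pV2 ?posrE ?exprn_gt0. Qed.

Lemma sqr_sigma_shift i l : (i + l < k + d)%N ->
  s (i + l).+1 ^+ 2 = s i.+1 ^+ 2 * r ^+ l.
Proof.
move=> il; rewrite !sE; [|lia..].
by rewrite /r -!exprVn -addSn exprD -(exprAC _ l 2); ring.
Qed.

(** The factors with l < i multiply to at most 4/3 by [prod_1_sub_expr_ge], and each of the k - i -
    1 factors with l > i is at most 1/4. *)
Lemma lagrange_mx_le (j : 'I_d) (i : 'I_k) :
  `|lagrange_mx s k d j i| <= 4 / 3 * 4^-1 ^+ (k - i.+1).
Proof.
have ik := ltn_ord i; have jd := ltn_ord j.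
(* For l < i the numerator is at most x and the denominator is x (1 - r^(i-l)), where x = s_(l+1)^2;
   for l > i the quotient is at most r^(l-i) / (1 - r^(l-i)) <= 1/4, as r <= 1/5. *)
pose w l : R := if (l < i)%N then (1 - r ^+ (i - l))^-1 else 4^-1.
have rX e : 0 <= r ^+ e by rewrite exprn_ge0 ?ltW.
have rS e : r ^+ e.+1 <= 5^-1.
  apply: le_trans r_le5; rewrite exprS ler_piMr ?(ltW r_gt0) //.
  by apply: exprn_ile1; [exact: ltW | apply: le_trans r_le5 _; lra].
have w_ge0 l : 0 <= w l.
  rewrite /w; case: ltnP => li; last lra.
  have [e ->] : exists e, (i - l = e.+1)%N by exists (i - l).-1; lia.
  by rewrite invr_ge0; have := rS e; lra.
have wP (l : 'I_k) : l != i ->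
    `|s (k + j).+1 ^+ 2 - s l.+1 ^+ 2| <= w l * `|s i.+1 ^+ 2 - s l.+1 ^+ 2|.
  move=> li; have lk := ltn_ord l.
  have sJ : s (k + j).+1 ^+ 2 <= s l.+1 ^+ 2.
    apply: le_sqr; first by rewrite ltW ?s_gt0 //; lia.
    by apply: decreasing_upto_le s_dec _ _; lia.
  have sJ0 := sqr_ge0 (s (k + j).+1).
  rewrite ler0_norm ?subr_le0 // /w; case: ltnP => [lti|ile].
    have [e le] : exists e, (i = l + e.+1 :> nat)%N by exists (i - l).-1; lia.
    have -> : (i - l = e.+1)%N by lia.
    rewrite le (@sqr_sigma_shift l e.+1); last lia.
    have := sqr_ge0 (s l.+1); have := rS e; have := rX e.+1.
    move: (r ^+ e.+1) (s l.+1 ^+ 2) => y x y0 y5 x0.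
    rewrite distrC ger0_norm; last by rewrite subr_ge0 ler_piMr //; lra.
    rewrite -{2}[x]mulr1 -mulrBr [x * _]mulrC mulKf; [lra|].
    by rewrite gt_eqF //; lra.
  have [e le] : exists e, (l = i + e.+1 :> nat)%N.
    by exists (l - i).-1; move: li; rewrite -val_eqE /=; lia.
  move: sJ; rewrite le (@sqr_sigma_shift i e.+1); last lia.
  have := sqr_ge0 (s i.+1); have := rS e; have := rX e.+1.
  move: (r ^+ e.+1) (s i.+1 ^+ 2) => y x y0 y5 x0 sJ.
  have xy : x * y <= x * 5^-1 by apply: ler_wpM2l.
  by rewrite ger0_norm; lra.
have := lagrange_mxP s_gt0 s_dec j i => /(congr1 Num.norm).
rewrite normrM !normr_prod => LE.
have den_gt0 : 0 < \prod_(l < k | l != i) `|s i.+1 ^+ 2 - s l.+1 ^+ 2|.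
  apply: prodr_gt0 => l li; rewrite normr_gt0 subr_eq0; apply: contra li => /eqP sil.
  rewrite -val_eqE; apply/eqP/esym.
  by apply: (sqr_sigma_inj s_gt0 s_dec _ _ sil); rewrite ltn_addr.
rewrite -(ler_pM2r den_gt0) LE.
apply: (@le_trans _ _ (\prod_(l < k | l != i) (w l * `|s i.+1 ^+ 2 - s l.+1 ^+ 2|))).
  by apply: ler_prod => l li; rewrite normr_ge0 wP.
rewrite big_split /= ler_wpM2r ?(ltW den_gt0) //.
have -> : \prod_(l < k | l != i) w l = \prod_(0 <= l < k | l != i) w l.
  by rewrite big_mkord.
rewrite (big_cat_nat (n := i)) //=; last exact: ltnW.
rewrite [X in _ * X]big_ltn_cond // eqxx.
have -> : \prod_(0 <= l < i | l != i) w l = \prod_(0 <= l < i) (1 - r ^+ (i - l))^-1.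
  rewrite big_nat_cond [RHS]big_nat_cond; apply: eq_big => l.
    by case: (ltnP l i) => [li|]; rewrite ?andbF //= ltn_eqF.
  by rewrite /w => /andP[/andP[_ ->]].
have -> : \prod_(i.+1 <= l < k | l != i) w l = 4^-1 ^+ (k - i.+1).
  rewrite -prodr_const_nat big_nat_cond [RHS]big_nat_cond; apply: eq_big => l.
    by case: (ltnP i l) => [li|]; rewrite ?andbF //= gtn_eqF.
  by rewrite /w => /andP[/andP[il _] _]; rewrite ltnNge (ltnW il).
apply: ler_wpM2r; first by rewrite exprn_ge0 // invr_ge0.
have := prod_1_sub_expr_ge i (ltW r_gt0) r_le5; rewrite prodfV.
move: (\prod_(_ <= _ < _) _) => P P34; have P0 : 0 < P by lra.
have -> : 4 / 3 = (3 / 4)^-1 :> R by field.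
by rewrite lef_pV2 // posrE; lra.
Qed.

Lemma severe_epsilon_lt :
  sqr_epsilon s (Delta_block s c k d) < s k.+1 ^+ 2.
Proof.
apply: le_lt_trans (sum_specnorm_le_frobenius _ _) _.
have sk : 0 < s k.+1 ^+ 2 by rewrite exprn_gt0 // s_gt0 //; lia.
(* The three factors come from s_(k+j+1)^2 = s_(k+1)^2 r^j, from the squared coefficient ratio, at
   most r <= 1/5, and from the square of [lagrange_mx_le]. *)
have entry (i : 'I_k) (j : 'I_d) : (Sigma_mx s k *m (Delta_block s c k d)^T) i j ^+ 2
    <= s k.+1 ^+ 2 * r ^+ j * (5^-1 * (16 / 9) * 16^-1 ^+ (k - i.+1)).
  rewrite mul_diag_mx [X in X ^+ 2 <= _]mxE [(\row__ _) _ _]mxE [_^T _ _]mxE.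
  have ik := ltn_ord i; have jd := ltn_ord j.
  rewrite Delta_blockE // !exprMn -sqr_sigma_shift ?ltn_add2l // -mulrA.
  apply: ler_wpM2l; first exact: sqr_ge0.
  have ci : 0 < `|c i.+1| by rewrite normr_gt0 c_neq0 //; lia.
  have cE : (c (k + j).+1 / c i.+1) ^+ 2 <= 5^-1.
    apply: le_trans r_le5; rewrite /r -exprVn -real_normK ?num_real //.
    apply: le_sqr => //; rewrite normrM normfV ler_pdivrMr //.
    by apply: c_decay; lia.
  have LE : lagrange_mx s k d j i ^+ 2 <= 16 / 9 * 16^-1 ^+ (k - i.+1).
    rewrite -real_normK ?num_real //.
    apply: le_trans (le_sqr (normr_ge0 _) (lagrange_mx_le j i)) _.
    have -> : 16^-1 = 4^-1 ^+ 2 :> R by field.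
    by rewrite exprMn exprAC le_eqVlt; apply/orP; left; apply/eqP; field.
  by rewrite -exprMn -[X in _ <= X]mulrA; apply: ler_pM; rewrite ?sqr_ge0.
(* The sum over j is at most 5/4 = 1/(1 - 1/5); with 16/15 = 1/(1 - 1/16) for the sum over i, the
   total constant is 128/135 < 1. *)
apply: (@le_lt_trans _ _ (2 * (\sum_(i < k) s k.+1 ^+ 2
    * (5^-1 * (16 / 9) * 16^-1 ^+ (k - i.+1)) * (5 / 4)))).
  rewrite ler_pM2l //; apply: ler_sum => i _.
  apply: le_trans (ler_sum _ (fun j _ => entry i j)) _.
  rewrite -mulr_suml -mulr_sumr mulrAC; apply: ler_wpM2l.
    by rewrite mulr_ge0 ?sqr_ge0 // mulr_ge0 ?exprn_ge0 ?invr_ge0 //; lra.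
  by apply: sum_expr_le; [exact: ltW | lra | move: r_le5; lra].
rewrite -mulr_suml -mulr_sumr -mulr_sumr.
have geo : \sum_(i < k) 16^-1 ^+ (k - i.+1) <= 16 / 15 :> R.
  rewrite (reindex_inj rev_ord_inj) /=.
  under eq_bigr => i _ do rewrite subnSK // subKn ?(ltnW (ltn_ord i)) //.
  by apply: sum_expr_le; lra.
move: sk geo; move: (s k.+1 ^+ 2) (\sum_(i < k) _) => x g x0 g16.
have : x * g <= x * (16 / 15) by rewrite ler_pM2l.
lra.
Qed.

End SeverelyIllPosed.

(** * Bounds for the Ritz values of the Lanczos process *)

Section RitzValues.
Variable R : realType.

Lemma sqrt_eta (s c : nat -> R) n k : 0 < s k.+1 ->
  Num.sqrt (1 + eta s c n k ^+ 2) * s k.+1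
  = Num.sqrt (sqr_epsilon s (Delta_block s c k (n - k)) + s k.+1 ^+ 2).
Proof.
move=> sk; have sk2 : 0 <= s k.+1 ^+ 2 by apply: sqr_ge0.
rewrite -[X in _ * X](ger0_norm (ltW sk)) -sqrtr_sqr -sqrtrM; last first.
  by rewrite addr_ge0 // sqr_ge0.
congr Num.sqrt; rewrite /eta expr_div_n sqr_sqrtr; last first.
  by rewrite addr_ge0 ?sqr_ge0.
by rewrite mulrDl mul1r mulfVK ?expf_neq0 ?gt_eqF // addrC.
Qed.

Variables (m k d : nat) (A : 'M[R]_(m, k + d)) (b : 'cV[R]_m).
Variables (u : nat -> 'cV[R]_m) (s : nat -> R) (v : nat -> 'cV[R]_(k + d)).
Variables (al be : nat -> R) (p : nat -> 'cV[R]_m) (q : nat -> 'cV[R]_(k + d)).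
Variable th : nat -> R.
Hypothesis nm : (k + d <= m)%N.
Hypothesis svdA : is_svd A u s v.
Hypothesis s_dec : decreasing_upto (k + d) s.
Hypothesis s_gt0 : forall i, (1 <= i <= k + d)%N -> 0 < s i.
Hypothesis c_neq0 : forall i, (1 <= i <= k + d)%N -> dotv (u i) b != 0.
Hypothesis lanczos : lanczos_bidiag A b al be p q.
Hypothesis svdB : singular_values (bidiag_mx al be k) th.
Hypothesis th_dec : decreasing_upto k th.
Hypothesis d_gt0 : (0 < d)%N.

Let c i := dotv (u i) b.

Lemma ritz_bounds i : (i < k)%N ->
  th i.+1 < s i.+1 <= th i.+1 +
    Num.sqrt (sqr_epsilon s (Delta_block s c k d) + s k.+1 ^+ 2).
Proof.
move=> ik; have kn : (k <= k + d)%N by apply: leq_addr.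
have kn' : (k < k + d)%N by lia.
have [_ VV _ _] := svdA.
have [ub [vb svdb]] := svdB; have [_ VbVb th_ge0 _] := svdb.
pose V := colsmx v (k + d); pose Q := colsmx q k; pose Vb := colsmx vb k.
(* [Vb] diagonalizes B_k^T B_k, so the columns of [X] are the Ritz vectors in the basis of right
   singular vectors of A. *)
pose W := V^T *m Q; pose X := W *m Vb.
have VW M : V *m (W *m M) = Q *m M :> 'cV_(k + d).
  by rewrite /W !mulmxA (mulmx1C VV) mul1mx.
have WW : W^T *m W = 1%:M.
  rewrite trmx_mul trmxK -mulmxA (mulmxA V) (mulmx1C VV) mul1mx.
  exact: lanczos_Q_orthonormal lanczos _ kn.
have XX : X^T *m X = 1%:M.
  by rewrite trmx_mul -mulmxA (mulmxA W^T) WW mul1mx.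
have energy y : norm2 (Sigma_mx s (k + d) *m (X *m y)) = norm2 (Sigma_mx th k *m y).
  rewrite -(svd_energy nm svdA) -/V /X -(mulmxA W) VW -(lanczos_energy lanczos) //.
  exact: svd_energy (leqnSn k) svdb _.
have /choice[f fP] : forall l : 'I_k, exists f : {poly R}, (size f <= k)%N /\
    forall j, W j l = s j.+1 * c j.+1 * f.[s j.+1 ^+ 2].
  move=> l; have l_n := leq_trans (ltn_ord l) kn.
  have [f fl fE] := lanczos_krylov lanczos nm svdA l_n.
  exists f; split=> [|j]; first exact: leq_trans fl (ltn_ord l).
  by rewrite -fE !mxE; apply: eq_bigr => h _; rewrite !mxE.
have [M WM] := krylov_col_mx s_gt0 s_dec c_neq0 (fun l => (fP l).1)
  (fun j l => (fP l).2 j).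
apply/andP; split.
  apply: (ritz_upper kn s_dec s_gt0 th_dec th_ge0 XX energy ik) => y j0 Xy0.
  (* X y has coordinates sigma_j c_j g(sigma_j^2) with deg g < k; if they vanish off j0, g has k + d
     - 1 >= k distinct roots. *)
  pose g := \sum_l (Vb *m y) l 0 *: f l.
  have XyE j : (X *m y) j 0 = s j.+1 * c j.+1 * g.[s j.+1 ^+ 2].
    rewrite -mulmxA mxE horner_sum mulr_sumr; apply: eq_bigr => l _.
    by rewrite (fP l).2 hornerZ; ring.
  suff g0 : g = 0 by apply/colP => j; rewrite XyE g0 horner0 mulr0 mxE.
  have ur : uniq (rem (val j0) (iota 0 (k + d))) by rewrite rem_uniq ?iota_uniq.
  have mem_r j : j \in rem (val j0) (iota 0 (k + d)) -> (j != j0) && (j < k + d)%N.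
    by rewrite mem_rem_uniq ?iota_uniq // inE mem_iota.
  apply: (poly_sigma_eq0 s_gt0 s_dec ur).
  - rewrite size_rem ?mem_iota ?ltn_ord // size_iota.
    apply: (@leq_trans k); last by lia.
    apply: leq_trans (size_sum _ _ _) _; apply/bigmax_leqP => l _.
    exact: leq_trans (size_scale_leq _ _) (fP l).1.
  - by move=> j /mem_r/andP[].
  - move=> j /mem_r/andP[jj0 jn].
    have := Xy0 (Ordinal jn); rewrite -val_eqE => /(_ jj0).
    have j1 : (1 <= j.+1 <= k + d)%N by [].
    rewrite XyE /= => /eqP; rewrite !mulf_eq0 (negbTE (c_neq0 j1)) gt_eqF ?s_gt0 //=.
    by move=> /eqP.
apply: (ritz_lower kn s_dec s_gt0 th_dec th_ge0 XX energy ik) => z.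
(* [Vb] is square orthogonal, so X and W define the same projector. *)
have -> : X *m (X^T *m z) = W *m (W^T *m z).
  by rewrite /X trmx_mul -!mulmxA (mulmxA Vb) (mulmx1C VbVb) mul1mx.
exact: projection_defect s_gt0 s_dec d_gt0 WM WW z.
Qed.

End RitzValues.

(** * Coefficient decay and gaps between singular values *)

Lemma le_transition_coef (R : realType) n (s c : nat -> R) (beta : R) k0 k i j :
  0 < beta -> decreasing_upto n s -> (forall i, (1 <= i <= n)%N -> 0 < s i) ->
  transition_point n s c beta k0 -> (1 <= k <= k0)%N ->
  (1 <= i <= k)%N -> (k < j <= n)%N -> `|c j| <= s k.+1 / s k * `|c i|.
Proof.
move=> b0 s_dec s_gt0 [k0n cE ratio] kk0 ik jn.
have s_le l l' : (1 <= l)%N -> (l <= l')%N -> (l' <= n)%N -> s l' <= s l.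
  move=> l1; rewrite leq_eqVlt => /predU1P[->//|ll'] l'n; exact/ltW/s_dec.
have [+ _] := ratio _ kk0.
set M := \big[Num.max/0]_(_ <= _ < _) _; set N := \big[Num.min/_]_(_ <= _ < _) _.
have sk : 0 < s k by apply: s_gt0; lia.
have sk1 : 0 < s k.+1 by apply: s_gt0; lia.
have cM : `|c j| <= M.
  apply: (@le_bigmax_seq _ R nat _ _ j xpredT (fun j => `|c j|)) => //.
  by rewrite mem_index_iota; lia.
have Nc : N <= `|c i|.
  apply: (@ge_bigmin_seq _ R nat _ _ i xpredT (fun i => `|c i|)) => //.
  by rewrite mem_index_iota; lia.
have N0 : 0 < N.
  have c_gt0 l : (1 <= l <= k)%N -> 0 < `|c l|.
    move=> lk; rewrite cE; last lia.
    by rewrite powR_gt0 // s_gt0 //; lia.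
  rewrite /N big_nat_cond; apply: (big_ind (fun x => 0 < x)).
  - by apply: c_gt0; lia.
  - by move=> x y x0 y0; rewrite lt_min x0.
  - by move=> l /andP[lk _]; apply: c_gt0; lia.
move=> /(canRL (mulfVK (lt0r_neq0 N0))) ME.
apply: le_trans cM _; rewrite ME; apply: ler_pM => //.
- by rewrite divr_ge0 ?powR_ge0.
- exact: ltW.
(* Splitting off one power leaves (s_(k+1) / s_k)^beta <= 1, since beta > 0. *)
have powE x : 0 < x -> x `^ (1 + beta) = x * x `^ beta.
  by move=> x0; rewrite powRD ?(gt_eqF x0) ?implybT // powRr1 // ltW.
rewrite !powE // invfM mulrACA ler_piMr ?divr_ge0 ?(ltW sk) ?(ltW sk1) //.
rewrite ler_pdivrMr ?powR_gt0 // mul1r ge0_ler_powR ?nnegrE ?ltW //.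
by apply: s_dec; lia.
Qed.

Lemma severe_sqrt_eta_lt (R : realType) n (s c : nat -> R) (zeta rho beta : R) k0 k :
  decreasing_upto n s -> (forall i, (1 <= i <= n)%N -> 0 < s i) ->
  (forall i, (1 <= i <= n)%N -> c i != 0) -> 0 < zeta -> 0 < beta ->
  severely_ill_posed n s zeta rho -> 5 <= rho ^+ 2 ->
  transition_point n s c beta k0 -> (1 <= k <= k0)%N ->
  Num.sqrt (1 + eta s c n k ^+ 2) < Num.sqrt 2.
Proof.
move=> s_dec s_gt0 c_neq0 zeta0 beta0 [rho1 sE] rho5 trans kk0.
have [k_gt0 d_gt0 nE] : [/\ (0 < k)%N, (0 < n - k)%N & n = (k + (n - k))%N].
  by case: trans => [k0n _ _]; move: kk0 k0n; clear; split; lia.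
have kn : (1 <= k <= n)%N by move: k_gt0 d_gt0; clear; lia.
have kn1 : (1 <= k.+1 <= n)%N by move: k_gt0 d_gt0; clear; lia.
have sk := s_gt0 _ kn1; have rho0 : 0 < rho by apply: lt_trans rho1.
(* Multiplied by sigma_(k+1) and squared, the claim is epsilon_k^2 + sigma_(k+1)^2 < 2
   sigma_(k+1)^2. *)
rewrite -(ltr_pM2r sk) sqrt_eta // -[X in _ < _ * X](ger0_norm (ltW sk)).
rewrite -[X in _ < _ * X]sqrtr_sqr -sqrtrM // ltr_sqrt; last first.
  by rewrite mulr_gt0 // exprn_gt0.
rewrite mulr_natl mulr2n ltrD2r.
have c_decay i j : (1 <= i <= k)%N -> (k < j <= n)%N -> `|c j| <= rho^-1 * `|c i|.
  have -> : rho^-1 = s k.+1 / s k.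
    by rewrite !sE // exprS; field; rewrite expf_neq0 ?gt_eqF.
  exact: le_transition_coef trans kk0.
move: (n - k)%N d_gt0 nE => d d_gt0 nE; subst n.
exact: severe_epsilon_lt rho0 rho5 sE c_decay.
Qed.

(** (i + 1) / i decreases in i, so the assumption made at k controls the gaps at all i <= k. *)
Lemma powR_gap (R : realType) (zeta alpha : R) (k i : nat) :
  0 < zeta -> 0 <= alpha -> (1 <= i <= k)%N ->
  (k.+1%:R / k%:R) `^ alpha * (zeta * i.+1%:R `^ (- alpha))
  <= zeta * i%:R `^ (- alpha).
Proof.
move=> zeta0 alpha0 /andP[i_gt0 ik].
have i0 : 0 < i%:R :> R by rewrite ltr0n.
have k0 : 0 < k%:R :> R by rewrite ltr0n (leq_trans i_gt0).
have i1E : i.+1%:R `^ alpha = (i.+1%:R / i%:R) `^ alpha * i%:R `^ alpha.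
  by rewrite -powRM ?divr_ge0 // divfK ?gt_eqF.
rewrite !powRN i1E mulrCA ler_pM2l // invfM mulrA.
rewrite ler_piMl ?invr_ge0 ?powR_ge0 // ler_pdivrMr ?powR_gt0 ?divr_gt0 // mul1r.
apply: ge0_ler_powR; rewrite ?nnegrE ?divr_ge0 //.
by rewrite -!natr1 !mulrDl !mul1r !divff ?gt_eqF // lerD2l lef_pV2 ?posrE // ler_nat.
Qed.

Theorem theorem4p1 (R : realType) (m n : nat) (A : 'M[R]_(m, n))
    (u : nat -> 'cV[R]_m) (sigma : nat -> R) (v : nat -> 'cV[R]_n)
    (xtrue : 'cV[R]_n) (e b : 'cV[R]_m) (beta zeta rho alpha : R)
    (al be : nat -> R) (p : nat -> 'cV[R]_m) (q : nat -> 'cV[R]_n)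
    (theta : nat -> nat -> R)
    (hmn : (n <= m)%N)
    (hsvd : is_svd A u sigma v)
    (hsimple : decreasing_upto n sigma)
    (hpos : forall i, (1 <= i <= n)%N -> 0 < sigma i)
    (hb : b = A *m xtrue + e)
    (hub : forall i, (1 <= i <= n)%N -> dotv (u i) b != 0)
    (hbeta : 0 < beta)
    (hpicard : forall i, (1 <= i <= n)%N ->
       `|dotv (u i) (A *m xtrue)| = sigma i `^ (1 + beta))
    (hlanczos : lanczos_bidiag A b al be p q)
    (hzeta : 0 < zeta)
    (hill : severely_ill_posed n sigma zeta rho \/
            mod_mildly_ill_posed n sigma zeta alpha)
    (hritz : forall k, (1 <= k < n)%N ->
       singular_values (bidiag_mx al be k) (theta k) /\
       decreasing_upto k (theta k)) :
  let c := fun i => dotv (u i) b in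
  (forall k i, (1 <= k < n)%N -> (1 <= i <= k)%N ->
     0 < sigma i - theta k i
       <= Num.sqrt (1 + eta sigma c n k ^+ 2) * sigma k.+1)
  /\
  (forall k0 kstar,
     transition_point n sigma c beta k0 ->
     semi_convergence_at (lsqr_iterate b al be p q) xtrue kstar ->
     (kstar <= k0)%N ->
     forall k, (1 <= k <= kstar)%N ->
     (severely_ill_posed n sigma zeta rho /\ 1 + Num.sqrt 2 <= rho) \/
     (mod_mildly_ill_posed n sigma zeta alpha /\
      1 + Num.sqrt (1 + eta sigma c n k ^+ 2) < (k.+1%:R / k%:R) `^ alpha) ->
     forall i, (1 <= i <= k)%N -> sigma i.+1 < theta k i < sigma i).
Proof.
move=> c.
have bounds k i : (1 <= k < n)%N -> (1 <= i <= k)%N ->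
    theta k i < sigma i <= theta k i + Num.sqrt (1 + eta sigma c n k ^+ 2) * sigma k.+1.
  case: i => [|i] kn; rewrite ?ltnn // => /andP[_ ik].
  have [svdB th_dec] := hritz k kn.
  have [d_gt0 nE] : (0 < n - k)%N /\ n = (k + (n - k))%N by move: kn; clear; lia.
  have sk : 0 < sigma k.+1 by apply: hpos; case/andP: kn.
  (* The types of A and v depend on n, so n - k becomes a variable d before n is replaced by k +
     d. *)
  rewrite sqrt_eta //; move: (n - k)%N d_gt0 nE => d d_gt0 nE; subst n.
  exact: ritz_bounds hmn hsvd hsimple hpos hub hlanczos svdB th_dec d_gt0 _ ik.
split=> [k i kn ik|k0 kstar trans _ ksk0 k kks hyp i ik].
  by have /andP[h1 h2] := bounds k i kn ik; rewrite subr_gt0 h1 lerBlDl.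
have k0n : (1 <= k0 < n)%N by case: trans.
have [kk0 kn i_n i1n] :
    [/\ (1 <= k <= k0)%N, (1 <= k < n)%N, (1 <= i <= n)%N & (1 <= i.+1 <= n)%N].
  by move: k0n kks ksk0 ik; clear; split; lia.
have /andP[h1 h2] := bounds k i kn ik; rewrite h1 andbT.
have si : 0 < sigma i.+1 by apply: hpos.
have s_le : sigma k.+1 <= sigma i.+1.
  by apply: decreasing_upto_le hsimple _ _; [case/andP: ik | case/andP: kn].
set g := Num.sqrt _ in h2 hyp.
(* Such a t gives theta_i >= sigma_i - g sigma_(k+1) > sigma_(i+1), because sigma_(k+1) <=
   sigma_(i+1). *)
suff [t gt tE] : exists2 t, 1 + g < t & t * sigma i.+1 <= sigma i.
  have : (1 + g) * sigma i.+1 < t * sigma i.+1 by rewrite ltr_pM2r.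
  have : g * sigma k.+1 <= g * sigma i.+1 by rewrite ler_wpM2l ?sqrtr_ge0.
  lra.
case: hyp => [[sev rho2]|[[alpha2 sE] gt]]; last first.
  exists ((k.+1%:R / k%:R) `^ alpha) => //.
  by rewrite !sE //; apply: powR_gap => //; lra.
have [rho1 sE] := sev; exists rho; last first.
  by rewrite !sE // exprS invfM mulrCA mulVKf ?lexx // gt_eqF //; lra.
(* (1 + sqrt 2)^2 = 3 + 2 sqrt 2 >= 5. *)
have rho5 : 5 <= rho ^+ 2.
  have t2 : Num.sqrt 2 ^+ 2 = 2 :> R by rewrite sqr_sqrtr.
  have t1 : 1 <= Num.sqrt 2 :> R by rewrite -[X in X <= _]sqrtr1 ler_sqrt // ler1n.
  apply: le_trans (le_sqr _ rho2); rewrite ?addr_ge0 ?sqrtr_ge0 // sqrrD t2; lra.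
(* It remains to see g < sqrt 2, that is, eta_k < 1. *)
apply: lt_le_trans rho2; rewrite ltrD2l.
exact: severe_sqrt_eta_lt hsimple hpos hub hzeta hbeta sev rho5 trans kk0.
Qed.
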